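(* Let $k>i\geq 1$ be integers. For $m,n\ge0$ let $\widetilde{O}_{k,i}(m,n)$ denote the number of overpartitions $\lambda$ of $n$ with exactly $m$ parts such that, for all $t\ge 0$, (1) $f_{\overline{1}}(\lambda)+f_2(\lambda)\leq i-1$; (2) $f_{2t}(\lambda)+f_{\overline{2t}}(\lambda)+f_{\overline{2t+1}}(\lambda)+f_{2t+2}(\lambda)\leq k-1$; (3) if $f_{2t+1}(\lambda)\geq 1$, then $f_{2t+2}(\lambda)\leq k-2$; (4) if $f_{2t}(\lambda)+f_{\overline{2t}}(\lambda)+f_{\overline{2t+1}}(\lambda)+f_{2t+2}(\lambda)=k-1$, then $tf_{2t}(\lambda)+tf_{\overline{2t}}(\lambda)+tf_{\overline{2t+1}}(\lambda)+(t+1)f_{2t+2}(\lambda)\equiv V_{2t+1}(\lambda)+i-1\pmod 2$; (5) if $f_{2t+1}(\lambda)\geq 1$ and $f_{2t+2}(\lambda)=k-2$, then $t+(t+1)f_{2t+2}(\lambda)\equiv V_{2t+1}(\lambda)+i-1\pmod 2$. Then $$\sum_{m,n\geq0}\widetilde{O}_{k,i}(m,n)x^mq^n=\sum_{N_{1}\geq \cdots\geq N_{k-1}\geq 0}\frac{(-q^{2-2N_1};q^2)_{N_1-1}(-q^{1-2N_1};q^2)_{N_1}\,q^{2(N^2_1+\cdots+N^2_{k-1}+N_{i+1}+\cdots+N_{k-1})}(1+q^{2N_i})\,x^{N_1+\cdots+N_{k-1}}}{(q^2;q^2)_{N_1-N_2}\cdots(q^2;q^2)_{N_{k-2}-N_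{k-1}}(q^{4};q^{4})_{N_{k-1}}}.$$
   Context: An overpartition of $n$ is a partition of $n$ in which the first occurrence of each number may be overlined (so each overlined part $\overline{t}$ occurs at most once). For an overpartition $\lambda$ and $t\ge1$, $f_t(\lambda)$ is the number of non-overlined parts equal to $t$, and $f_{\overline{t}}(\lambda)\in\{0,1\}$ is the number of overlined parts $\overline{t}$; $f_0=f_{\overline{0}}=0$. $V_s(\lambda)$ is the number of overlined parts of $\lambda$ of size not exceeding $s$. $(a;q)_\infty=\prod_{j\ge0}(1-aq^j)$ and $(a;q)_n=(a;q)_\infty/(aq^n;q)_\infty$ for every integer $n$ (in particular, when $N_1=0$ the factor $(-q^{2};q^2)_{-1}$ equals $1/2$). The sum $N_{i+1}+\cdots+N_{k-1}$ is empty (equal to $0$) when $i=k-1$, and for $k=2$ the denominator is just $(q^4;q^4)_{N_1}$. The identity is one of formal power series. *)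

(* Defs.v *)
From HB Require Import structures.
From mathcomp Require Import all_boot all_order all_algebra.
From mathcomp Require Import boolp classical_sets.
Set Implicit Arguments.
Unset Strict Implicit.
Unset Printing Implicit Defensive.
Import GRing.Theory.
Local Open Scope ring_scope.

Record fps (R : Type) := Fps { fcoef : nat -> R }.
Coercion fcoef : fps >-> Funclass.

Lemma fpsP (R : Type) (f g : fps R) : (forall n, f n = g n) -> f = g.
Proof. by case: f g => [f] [g] /= fg; congr Fps; apply/funext. Qed.

HB.instance Definition _ (R : Type) := gen_eqMixin (fps R).
HB.instance Definition _ (R : Type) := gen_choiceMixin (fps R).

Section FpsRing.
Variable R : comNzRingType.
Implicit Types f g h : fps R.

Definition fpsC (c : R) : fps R := Fps (fun n => if n == 0%N then c else 0).
Definition fpsX : fps R := Fps (fun n => (n == 1%N)%:R).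
Definition fps_add f g := Fps (fun n => f n + g n).
Definition fps_opp f := Fps (fun n => - f n).
Definition fps_mul f g := Fps (fun n => \sum_(j < n.+1) f j * g (n - j)%N).

Fact fps_addA : associative fps_add.
Proof. by move=> f g h; apply: fpsP => n /=; rewrite addrA. Qed.
Fact fps_addC : commutative fps_add.
Proof. by move=> f g; apply: fpsP => n /=; rewrite addrC. Qed.
Fact fps_add0 : left_id (fpsC 0) fps_add.
Proof. by move=> f; apply: fpsP => n /=; rewrite if_same add0r. Qed.
Fact fps_addN : left_inverse (fpsC 0) fps_opp fps_add.
Proof. by move=> f; apply: fpsP => n /=; rewrite if_same addNr. Qed.

HB.instance Definition _ :=
  GRing.isZmodule.Build (fps R) fps_addA fps_addC fps_add0 fps_addN.

Definition fps_trunc N f : {poly R} := \poly_(j < N.+1) f j.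

Fact coef_trunc N f n : (n <= N)%N -> (fps_trunc N f)`_n = f n.
Proof. by move=> nN; rewrite coef_poly ltnS nN. Qed.

Fact coef_truncM N f g n : (n <= N)%N ->
  fps_mul f g n = (fps_trunc N f * fps_trunc N g)`_n.
Proof.
move=> nN; rewrite coefM; apply: eq_bigr => j _.
by rewrite !coef_trunc // (leq_trans _ nN) ?leq_subr // -ltnS ltn_ord.
Qed.

Fact fps_mulC : commutative fps_mul.
Proof. by move=> f g; apply: fpsP => n; rewrite !(@coef_truncM n) // mulrC. Qed.

Fact fps_mulA : associative fps_mul.
Proof.
move=> f g h; apply: fpsP => n.
have -> : fps_mul f (fps_mul g h) n
    = (fps_trunc n f * (fps_trunc n g * fps_trunc n h))`_n.
  rewrite coefM; apply: eq_bigr => j _; rewrite coef_trunc -1?ltnS //.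
  by rewrite (@coef_truncM n) // leq_subr.
rewrite mulrA coefM; apply: eq_bigr => j _.
by rewrite -coef_truncM -1?ltnS // coef_trunc // leq_subr.
Qed.

Fact fps_mul1 : left_id (fpsC 1) fps_mul.
Proof.
move=> f; apply: fpsP => n /=; rewrite big_ord_recl /= mul1r subn0.
by rewrite big1 ?addr0 // => j _; rewrite mul0r.
Qed.

Fact fps_mulDl : left_distributive fps_mul fps_add.
Proof.
move=> f g h; apply: fpsP => n /=; rewrite -big_split /=.
by apply: eq_bigr => j _; rewrite mulrDl.
Qed.

Fact fps_one_neq0 : fpsC 1 != 0 :> fps R.
Proof.
apply/eqP => /(congr1 (fun f : fps R => f 0%N)) /= /eqP.
by rewrite oner_eq0.
Qed.

HB.instance Definition _ := GRing.Zmodule_isComNzRing.Build (fps R)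
  fps_mulA fps_mulC fps_mul1 fps_mulDl fps_one_neq0.

Definition fps_unit : pred (fps R) := fun f => `[< exists g : fps R, g * f = 1 >].
Definition fps_inv f : fps R :=
  if fps_unit f then xget f [set g | g * f = 1]%classic else f.

Fact fps_mulVr : {in fps_unit, left_inverse 1 fps_inv *%R}.
Proof.
move=> f fU; rewrite /fps_inv; have := fU; rewrite /in_mem /= => ->.
move/asboolP: fU => [g gf].
by case: xgetP => [h _ hf //|/(_ g)]; case.
Qed.
Fact fps_unitPl f g : g * f = 1 -> fps_unit f.
Proof. by move=> gf; apply/asboolP; exists g. Qed.
Fact fps_invr_out : {in [predC fps_unit], fps_inv =1 id}.
Proof. by move=> f; rewrite inE /fps_inv /in_mem /= => /negbTE ->. Qed.

HB.instance Definition _ := GRing.ComNzRing_hasMulInverse.Build (fps R)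
  fps_mulVr fps_unitPl fps_invr_out.

End FpsRing.
Arguments fpsX {R}.

Fact fps_neq0P (R : comNzRingType) (f : fps R) :
  f != 0 -> exists2 n, f n != 0 & forall m, (m < n)%N -> f m = 0.
Proof.
move=> f0; have ex : exists n, f n != 0.
  apply: contrapT => nex; case/eqP: f0; apply: fpsP => n /=; rewrite if_same.
  by apply/eqP; apply: contrapT => /negP fn; apply: nex; exists n.
exists (ex_minn ex); first by case: ex_minnP.
move=> m; case: ex_minnP => n _ minn mn; apply/eqP; apply: contraTT mn => fm.
by rewrite -leqNgt minn.
Qed.

Fact fps_integral (R : idomainType) (f g : fps R) :
  f * g = 0 -> (f == 0) || (g == 0).
Proof.
move=> fg; apply/norP => -[/fps_neq0P[a fa fm] /fps_neq0P[b gb gm]].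
have := congr1 (fun h : fps R => h (a + b)%N) fg.
rewrite /= (bigD1 (inord a)) //= inordK ?ltnS ?leq_addr // addKn big1.
  by rewrite addr0 if_same => /eqP; rewrite mulf_eq0 (negbTE fa) (negbTE gb).
move=> j ja; have {}ja : (j != a :> nat).
  by apply: contra ja => /eqP ja; apply/eqP/val_inj; rewrite /= inordK ?ltnS ?leq_addr.
case: (ltngtP j a) ja => // ja _; first by rewrite fm ?mul0r.
by rewrite (gm (a + b - j)%N) ?mulr0 // ltn_subLR ?ltn_add2r // -ltnS ltn_ord.
Qed.

HB.instance Definition _ (R : idomainType) :=
  GRing.ComUnitRing_isIntegral.Build (fps R) (@fps_integral R).

(* Formal summation of an infinite family in the discrete coefficientwise
   topology of R[[x]]: every coefficient is stable along finite index sets. *)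
Definition fps_has_sum (R : comNzRingType) (I : eqType) (P : pred I)
    (F : I -> fps R) (S : fps R) : Prop :=
  forall m : nat, exists s0 : seq I, forall s : seq I,
    uniq s -> {subset s0 <= s} -> (\sum_(j <- s | P j) F j) m = S m.

(* Q((q)), as the fraction field of Q[[q]]. *)
Notation laurent := {fraction (fps rat)}.

Definition q : laurent := tofrac (fpsX : fps rat).

Definition qadic_lim (u : nat -> laurent) (l : laurent) : Prop :=
  forall d : nat, exists B : nat, forall n : nat, (B <= n)%N ->
    exists s : fps rat, u n - l = q ^+ d * tofrac s.

(* (a;p)_oo, as a q-adic limit (0 if the product diverges). *)
Definition qpoch_inf (a p : laurent) : laurent :=
  xget 0 [set l | qadic_lim (fun B => \prod_(j < B) (1 - a * p ^+ j)) l]%classic.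

(* (a;p)_n for an arbitrary integer n. *)
Definition qpoch (a p : laurent) (n : int) : laurent :=
  qpoch_inf a p / qpoch_inf (a * p ^ n) p.

(* A part is a pair (t, b): its size t, and whether it is overlined. Parts are
   listed in nonincreasing order of size, and an overlined part must be the
   first occurrence of its size. *)
Definition part_next (x y : nat * bool) : bool :=
  (y.1 < x.1)%N || ((y.1 == x.1) && ~~ y.2).

Definition is_overpartition (n : nat) (l : seq (nat * bool)) : bool :=
  [&& sorted part_next l, all (fun x => 0 < x.1)%N l
    & sumn [seq x.1 | x <- l] == n].

Definition f (l : seq (nat * bool)) (t : nat) : nat := count_mem (t, false) l.
Definition fbar (l : seq (nat * bool)) (t : nat) : nat := count_mem (t, true) l.
Definition V (l : seq (nat * bool)) (s : nat) : nat :=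
  count (fun x => x.2 && (x.1 <= s)%N) l.

Definition O_cond (k i : nat) (l : seq (nat * bool)) : Prop :=
  forall t : nat,
  [/\ (fbar l 1 + f l 2 <= i - 1)%N,
      (f l (2 * t) + fbar l (2 * t) + fbar l (2 * t + 1) + f l (2 * t + 2)
         <= k - 1)%N,
      (1 <= f l (2 * t + 1))%N -> (f l (2 * t + 2) <= k - 2)%N,
      (f l (2 * t) + fbar l (2 * t) + fbar l (2 * t + 1) + f l (2 * t + 2)
         = k - 1)%N ->
        t * f l (2 * t) + t * fbar l (2 * t) + t * fbar l (2 * t + 1)
          + (t + 1) * f l (2 * t + 2)
        = V l (2 * t + 1) + (i - 1) %[mod 2]
    & (1 <= f l (2 * t + 1))%N -> (f l (2 * t + 2) = k - 2)%N ->
        t + (t + 1) * f l (2 * t + 2)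
        = V l (2 * t + 1) + (i - 1) %[mod 2]].

(* No generality is lost in bounding the parts of an overpartition of n by n. *)
Definition Otilde (k i m n : nat) : nat :=
  #|[set l : m.-tuple ('I_n.+1 * bool) |
      let l' := [seq (val x.1, x.2) | x <- l] in
      is_overpartition n l' && `[< O_cond k i l' >]]|.

(* An element of Q[[q]][[x]], embedded in Q((q))[[x]]. *)
Definition O_genfun (k i : nat) : fps laurent :=
  Fps (fun m => tofrac (Fps (fun n => (Otilde k i m n)%:R) : fps rat)).

(* Main.v *)
(* Let p = q^2, z = xq, y = xp, and let a hat denote the substitution
   x -> xp.  Write F_i for the multisum, and set F_0 = 0 and F_k = F_(k-1).
   Since (-q^2;q^2)_(N-1) (-q;q^2)_N q^N gets multiplied by
   q (1 + p^N) (1 + q p^N) when N increases by 1, telescoping over N_1 reduces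
     (1 - z) F_1 = (1 + y) F^_(k-1),
     (1 - z) (F_i - F_(i-1)) = y^(i-2) (1 + y) (y F^_(k-i) + z F^_(k-i+1))
   to two relations between the inner sums over N_2, ..., N_(k-1)
   (msum_rec and msum_diff), which go by induction on k.  On the other side,
   removing the parts of size at most 2 and subtracting 2 from the others sends
   the overpartitions with parameter i to those with parameter
     i' = k - f_2 - fbar_2 - [f_2 + fbar_1 + i - 1 odd],
   so the generating functions G_i satisfy a q-difference system with the
   initial value 1 at x = 0, which determines them.  The equations for the F_i
   sum up to the same system. *)
Require Import Defs.
From HB Require Import structures.
From mathcomp Require Import all_boot all_order all_algebra.
From mathcomp Require Import boolp classical_sets zify ring.
Import GRing.Theory.
Local Open Scope ring_scope.
Set Implicit Arguments.
Unset Strict Implicit.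
Unset Printing Implicit Defensive.

(** * Inner sums and their contiguous relations *)

Section InnerSums.
Variables (R : comNzRingType) (p : R) (ip ip2 : nat -> R).
Hypothesis ipS : forall n, ip n = ip n.+1 * (1 - p ^+ n.+1).
Hypothesis ip2S : forall n, ip2 n = ip2 n.+1 * (1 - p ^+ (2 * n.+1)).

Definition lag (B : nat -> R) N := if N is M.+1 then B M else 0.

(** One step of a Bailey chain: N is the outer summation variable, M the next one. *)
Definition bailey (x : R) (B : nat -> R) (N : nat) : R :=
  \sum_(M < N.+1) p ^+ (M ^ 2) * x ^+ M * ip (N - M) * B M.

(* With ip n = 1/(p;p)_n and ip2 n = 1/(p^2;p^2)_n, this is the sum over
   N_2 >= ... >= N_(k-1) for k = h + 2 and N_1 = N; the u innermost variables
   among N_1, ..., N_(k-1) carry an extra factor p^(N_j). *)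
Fixpoint msum (h u : nat) (x : R) (N : nat) : R :=
  p ^+ (N * (h < u)) *
  (if h is h'.+1 then bailey x (msum h' u x) N else ip2 N).

(** Lowering N by one multiplies [ip (N - M)] by 1 - p^(N-M); this factor vanishes at M = N, so the
    range of summation can stay the same. *)
Lemma bailey_lag (x : R) (B : nat -> R) N :
  lag (bailey x B) N = \sum_(M < N.+1)
    p ^+ (M ^ 2) * x ^+ M * ip (N - M) * ((1 - p ^+ (N - M)) * B M).
Proof.
case: N => [|N] /=; first by rewrite big_ord1 expr0 subrr mul0r mulr0.
rewrite big_ord_recr /= subnn expr0 subrr mul0r mulr0 addr0.
apply: eq_bigr => M _; rewrite subSn -1?ltnS // ipS; ring.
Qed.

Lemma sum_lag (g B : nat -> R) N :
  \sum_(M < N.+1) g M * ip (N - M) * lag B M =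
  \sum_(M < N.+1) g M.+1 * ip (N - M) * ((1 - p ^+ (N - M)) * B M).
Proof.
rewrite big_ord_recl /= mulr0 add0r big_ord_recr /= subnn expr0 subrr.
rewrite mul0r mulr0 addr0; apply: eq_bigr => M _ /=; rewrite /bump /= add1n.
rewrite subnS; case E: (N - M)%N => [|n]; first by move: (ltn_ord M); lia.
rewrite /= ipS; ring.
Qed.

(** The contiguous relation between B and C passes unchanged through a Bailey step, which makes
    [msum_rec] an induction on h. Writing p^N as p^(N-M) p^M exposes p^M C_M; once [sum_lag] has
    reindexed the lagged part, both sides agree term by term. *)
Lemma bailey_rec (x : R) (B C : nat -> R) :
  (forall M, p ^+ M * C M = (1 + x * p ^+ (2 * M)) * B M - lag B M) ->
  forall N, p ^+ N * bailey x C N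
            = (1 + x * p ^+ (2 * N)) * bailey x B N - lag (bailey x B) N.
Proof.
move=> CB N; rewrite bailey_lag /bailey !mulr_sumr -sumrB.
have E (M : 'I_N.+1) : p ^+ N = p ^+ (N - M) * p ^+ M.
  by rewrite -exprD subnK // -ltnS.
pose g M := p ^+ (N - M) * p ^+ (M ^ 2) * x ^+ M.
transitivity (\sum_(M < N.+1) g M * ip (N - M) * ((1 + x * p ^+ (2 * M)) * B M)
              - \sum_(M < N.+1) g M * ip (N - M) * lag B M).
  rewrite -sumrB; apply: eq_bigr => M _.
  by rewrite -mulrBr -CB {1}(E M) /g; ring.
rewrite (sum_lag g) -sumrB; apply: eq_bigr => M _; rewrite /g.
(* At M = N the truncated exponent in [g M.+1] is harmless, as it comes with 1 - p^(N-M) = 0. *)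
have [->|lt] := eqVneq (M : nat) N; first by rewrite subnn; ring.
have {}lt : (M < N)%N by rewrite ltn_neqAle lt -ltnS ltn_ord.
have -> : (2 * N = (N - M) + (N - M) + M + M)%N by lia.
have -> : (M.+1 ^ 2 = M ^ 2 + M + M + 1)%N by lia.
rewrite mul2n -addnn.
case En: (N - M)%N => [|n]; first by lia.
have -> : (N - M.+1 = n)%N by lia.
rewrite !exprD !exprS; ring.
Qed.

Lemma msumS h u x N : (u <= h.+1)%N ->
  msum h.+1 u x N = bailey x (msum h u x) N.
Proof. by move=> uh; rewrite /= ltnNge uh muln0 expr0 mul1r. Qed.

Lemma eq_bailey x B C : B =1 C -> bailey x B =1 bailey x C.
Proof. by move=> BC N; apply: eq_bigr => M _; rewrite BC. Qed.

Lemma eq_lag B C : B =1 C -> lag B =1 lag C.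
Proof. by move=> BC [|N] /=. Qed.

Lemma baileyDM x a B C N :
  bailey x (fun M => B M + a * C M) N = bailey x B N + a * bailey x C N.
Proof.
by rewrite mulr_sumr -big_split; apply: eq_bigr => M _ /=; ring.
Qed.

Lemma msum_sat h u v x N : (h < u)%N -> (h < v)%N -> msum h u x N = msum h v x N.
Proof.
elim: h N => [|h IH] N hu hv /=; rewrite hu hv //; congr (_ * _).
by apply: eq_bailey => M; apply: IH; apply: ltnW.
Qed.

Lemma msum_top h x N : msum h h.+1 x N = p ^+ N * msum h h x N.
Proof.
case: h => [|h] /=; first by rewrite muln1 muln0 mul1r.
rewrite ltnS leqnn muln1 ltnn muln0 expr0 mul1r; congr (_ * _).
by apply: eq_bailey => M; apply: msum_sat.
Qed.

(** All h summation variables carry p^(N_j), which amounts to turning x^(N_j) into (x p)^(N_j). *)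
Lemma msum_shift h x N : msum h h x N = msum h 0 (x * p) N.
Proof.
elim: h N => [|h IH] N; first by rewrite /= !muln0.
rewrite !msumS //; apply: eq_bigr => M _; rewrite msum_top IH exprMn; ring.
Qed.

(* The convention msum h (-1) = msum h 1 makes the relation below hold at u = 0. *)
Definition pred_refl u := if u is v.+1 then v else 1%N.

Lemma msum_rec h u x N : (u <= h)%N ->
  p ^+ N * (msum h (pred_refl u) x N + x * msum h u.+1 x N) =
  (1 + x * p ^+ (2 * N)) * msum h u x N - lag (msum h u x) N.
Proof.
elim: h u N => [|h IH] u N.
  rewrite leqn0 => /eqP -> /=; rewrite muln1 muln0 mul1r.
  case: N => [|N] /=; first by rewrite muln0 expr0; ring.
  by rewrite muln0 mul1r (ip2S N) mul2n -addnn exprD; ring.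
rewrite leq_eqVlt => /orP[/eqP->|uh]; last first.
  have r : (pred_refl u <= h.+1)%N by case: u uh => //= u; lia.
  have uh1 : (u <= h.+1)%N by apply: ltnW.
  rewrite (eq_lag (fun M => msumS _ _ uh1)) !msumS // -baileyDM.
  by apply: (bailey_rec (B := msum h u x)) => M; apply: IH.
(* Here u equals the new h, so u + 1 also marks the outer variable: by [msum_top] that term cancels
   x p^(2N), and [bailey_lag] gives the rest. *)
rewrite msum_top (eq_lag (fun M => msumS _ _ (leqnn _))) !msumS //=.
rewrite bailey_lag /bailey mulrDr !mulr_sumr -sumrB -big_split.
apply: eq_bigr => M _ /=; rewrite msum_top.
have E : p ^+ N = p ^+ (N - M) * p ^+ M by rewrite -exprD subnK // -ltnS.
rewrite mul2n -addnn exprD E; ring.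
Qed.

(** Moving M to M + 1 multiplies p^(M^2) x^M by x p^(2M+1), and the factor 1 - p^(N-M) coming from
    [ip] combines with p^M to p^M - p^N. *)
Lemma bailey_of_lag x B N :
  bailey x (lag B) N = bailey x (fun M => x * p * p ^+ M * (p ^+ M - p ^+ N) * B M) N.
Proof.
rewrite /bailey (sum_lag (fun M => p ^+ (M ^ 2) * x ^+ M)).
apply: eq_bigr => M _.
have -> : p ^+ N = p ^+ (N - M) * p ^+ M by rewrite -exprD subnK // -ltnS.
have -> : (M.+1 ^ 2 = M ^ 2 + M + M + 1)%N by lia.
rewrite !exprD !exprS; ring.
Qed.

(** Links sums at x to sums at x p. The induction lowers e together with h; at e = 0, [msum_top] and
    [msum_shift] express the left side through [msum h 0 y]. *)
Lemma msum_diff h e x N : (e < h)%N ->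
  msum h (h - e).-1 x N - msum h (h - e).+1 x N =
  (1 + x * p) * (x * p) ^+ e *
  (msum h e.+1 (x * p) N - p ^+ N * msum h e (x * p) N).
Proof.
elim: h e N => // h IH e N.
rewrite ltnS => eh; have {}eh : (e <= h)%N by lia.
set y := x * p.
have rec_e M := msum_rec y M eh.
case: e eh rec_e => [|e] eh rec_e.
  have rec0 M := msum_rec y M (leq0n h).
  rewrite subn0 succnK msum_top msum_shift -/y !msumS // expr0.
  have := bailey_of_lag x (msum h 0 y) N.
  rewrite (eq_bailey _ (C := fun M => (1 + y * p ^+ (2 * M)) * msum h 0 y M
    - p ^+ M * (msum h 1 y M + y * msum h 1 y M))); last first.
    by move=> M; rewrite rec0; ring.
  move=> L; apply/eqP; rewrite -subr_eq0; move/eqP: L; rewrite -subr_eq0 => /eqP L.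
  rewrite -L /bailey -!sumrB !mulr_sumr -!sumrB !mulr_sumr -!sumrB.
  apply/eqP/eq_bigr => M _; rewrite mul2n -addnn exprD !exprMn msum_shift /y; ring.
rewrite subSS !msumS; try by lia.
transitivity (bailey x (fun M => (1 + y) * y ^+ e *
      (msum h e.+1 y M - p ^+ M * msum h e y M)) N).
  rewrite /bailey -sumrB; apply: eq_bigr => M _; rewrite -IH // -/y; ring.
(* The Bailey transform of the lag of [msum h e.+1 y] is computed twice, by [msum_rec] and by
   [bailey_of_lag]. Up to the factor (1 + y) y^e, the resulting vanishing combination is the
   difference of the two sides. *)
have := bailey_of_lag x (msum h e.+1 y) N.
rewrite (eq_bailey _ (C := fun M => (1 + y * p ^+ (2 * M)) * msum h e.+1 y M
  - p ^+ M * (msum h e y M + y * msum h e.+2 y M))); last first.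
  by move=> M; rewrite rec_e; ring.
rewrite exprS => L.
apply/eqP; rewrite -subr_eq0; move/eqP: L; rewrite -subr_eq0 => /eqP L.
rewrite -(mulr0 ((1 + y) * y ^+ e)) -L /bailey -sumrB !mulr_sumr -!sumrB !mulr_sumr -!sumrB.
apply/eqP/eq_bigr => M _; rewrite mul2n -addnn exprD !exprMn /y; ring.
Qed.

(** * Summation over N_1 by telescoping *)

Variables (q : R) (w : nat -> R).
Hypothesis p_q : p = q * q.
Hypothesis wS : forall n, w n.+1 = w n * (q * (1 + p ^+ n) * (1 + q * p ^+ n)).

Definition psum h u M x := \sum_(N < M) w N * x ^+ N * msum h u x N.

(** By the recurrence for w, the subtracted part of the N-th summand is w_(N+1) x^(N+1) B_N, so the
    sum telescopes. *)
Lemma sum_weight_lag M x B :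
  \sum_(N < M) w N * x ^+ N *
     (lag B N - (x * q * (1 + p ^+ N) * (1 + q * p ^+ N)) * B N)
  = - (w M * x ^+ M * lag B M).
Proof.
elim: M => [|M IH]; first by rewrite big_ord0 mulr0 oppr0.
by rewrite big_ord_recr /= IH wS exprS; ring.
Qed.

(** The remainder x^M r is the boundary term of the telescoping sum for [msum h e.+1 y]. With a
    multiple of that sum added, the summands agree by [msum_diff] and [msum_rec]. *)
Lemma psum_diff h e x M : (e < h)%N ->
  exists r, (1 - x * q) * (psum h (h - e).-1 M x - psum h (h - e).+1 M x) =
  (1 + x * p) * (x * p) ^+ e *
    (x * p * (psum h e.+2 M (x * p) + psum h e.+1 M (x * p))
     + x * q * (psum h e.+1 M (x * p) + psum h e M (x * p))) + x ^+ M * r.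
Proof.
move=> eh; set y := x * p; set c := (1 + y) * y ^+ e.
exists (- c * (w M * lag (msum h e.+1 y) M)).
have L := sum_weight_lag M x (msum h e.+1 y).
transitivity (c * (y * (psum h e.+2 M y + psum h e.+1 M y)
  + x * q * (psum h e.+1 M y + psum h e M y))
  + c * - (w M * x ^+ M * lag (msum h e.+1 y) M)); last by ring.
rewrite -L /psum -!sumrB -!big_split !mulr_sumr -!big_split !mulr_sumr -!big_split.
apply: eq_bigr => N _ /=; rewrite -mulrBr msum_diff // -/y -/c.
have := @msum_rec h e.+1 y N eh; rewrite mul2n -addnn exprD /= => H.
have {}H : lag (msum h e.+1 y) N = (1 + y * (p ^+ N * p ^+ N)) * msum h e.+1 y N
  - p ^+ N * (msum h e y N + y * msum h e.+2 y N) by rewrite H; ring.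
by rewrite H [in y ^+ N]/y exprMn /y [in x * p]p_q; ring.
Qed.

Lemma psum_first h x M :
  exists r, (1 - x * q) * (psum h h.+1 M x + psum h h M x) =
  (1 + x * p) * (psum h 1 M (x * p) + psum h 0 M (x * p)) + x ^+ M * r.
Proof.
set y := x * p.
exists (- (w M * lag (msum h 0 y) M)).
have L := sum_weight_lag M x (msum h 0 y).
transitivity ((1 + y) * (psum h 1 M y + psum h 0 M y)
   - (w M * x ^+ M * lag (msum h 0 y) M)); last by ring.
rewrite -L /psum -!big_split !mulr_sumr -!big_split.
apply: eq_bigr => N _ /=; rewrite msum_top msum_shift -/y.
have := @msum_rec h 0 y N isT; rewrite mul2n -addnn exprD /= => H.
have {}H : lag (msum h 0 y) N = (1 + y * (p ^+ N * p ^+ N)) * msum h 0 y N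
  - p ^+ N * (msum h 1 y N + y * msum h 1 y N) by rewrite H; ring.
by rewrite H [in y ^+ N]/y exprMn /y [in x * p]p_q; ring.
Qed.
End InnerSums.

(** * Formal power series *)

Section FpsCoef.
Variable R : comNzRingType.
Implicit Types (f g : fps R) (c : R).

Lemma fps0E n : (0 : fps R) n = 0. Proof. exact: if_same. Qed.
Lemma fps1E n : (1 : fps R) n = (n == 0%N)%:R. Proof. by case: n. Qed.
Lemma fpsDE f g n : (f + g) n = f n + g n. Proof. by []. Qed.
Lemma fpsBE f g n : (f - g) n = f n - g n. Proof. by []. Qed.
Lemma fpsME f g n : (f * g) n = \sum_(j < n.+1) f j * g (n - j)%N.
Proof. by []. Qed.

Lemma fps_sumE I (r : seq I) (P : pred I) (F : I -> fps R) n :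
  (\sum_(j <- r | P j) F j) n = \sum_(j <- r | P j) F j n.
Proof. by elim/big_rec2: _ => [|j x y _ <-]; rewrite ?fps0E. Qed.

Lemma fpsCM_coef c f n : (fpsC c * f) n = c * f n.
Proof.
rewrite fpsME big_ord_recl subn0 big1 ?addr0 // => j _.
by rewrite mul0r.
Qed.

Lemma fpsXM_coef f n : (fpsX * f) n = if n is m.+1 then f m else 0.
Proof.
rewrite fpsME; case: n => [|n]; first by rewrite big_ord1 mul0r.
rewrite 2!big_ord_recl /= mul0r mul1r add0r big1 ?addr0 ?subn1 // => j _.
by rewrite mul0r.
Qed.

Lemma fpsXnM_coef M f n : (fpsX ^+ M * f) n = if (n < M)%N then 0 else f (n - M)%N.
Proof.
elim: M n => [|M IH] n; first by rewrite mul1r subn0.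
by rewrite exprS -mulrA fpsXM_coef; case: n => [|n] //; rewrite IH.
Qed.

Lemma fps_divXn M f : (forall n, (n < M)%N -> f n = 0) ->
  exists r, f = fpsX ^+ M * r.
Proof.
move=> f0; exists (Fps (fun n => f (n + M)%N)); apply: fpsP => n.
by rewrite fpsXnM_coef; case: ltnP => nM; [exact: f0 | rewrite /= subnK].
Qed.

Lemma fpsC_is_zmod_morphism : zmod_morphism (@fpsC R).
Proof. by move=> a b; apply: fpsP => -[|n] //=; rewrite subrr. Qed.

Lemma fpsC_is_monoid_morphism : monoid_morphism (@fpsC R).
Proof.
split=> [|a b] //; apply: fpsP => n; rewrite fpsCM_coef.
by case: n => //=; rewrite mulr0.
Qed.

HB.instance Definition _ := GRing.isZmodMorphism.Build R (fps R) (@fpsC R)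
  fpsC_is_zmod_morphism.
HB.instance Definition _ := GRing.isMonoidMorphism.Build R (fps R) (@fpsC R)
  fpsC_is_monoid_morphism.

(** The substitution of c x for x. *)
Definition dil c f : fps R := Fps (fun n => c ^+ n * f n).

Lemma dilE c f n : dil c f n = c ^+ n * f n. Proof. by []. Qed.

Lemma dil_is_zmod_morphism c : zmod_morphism (dil c).
Proof. by move=> f g; apply: fpsP => n; rewrite /= mulrBr. Qed.

Lemma dil_is_monoid_morphism c : monoid_morphism (dil c).
Proof.
split=> [|f g]; apply: fpsP => n.
  by rewrite /dil /=; case: n => [|n] /=; rewrite ?expr0 ?mul1r ?mulr0.
rewrite /= mulr_sumr; apply: eq_bigr => j _.
by rewrite mulrACA -exprD subnKC // -ltnS.
Qed.

HB.instance Definition _ c := GRing.isZmodMorphism.Build (fps R) (fps R) (dil c)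
  (dil_is_zmod_morphism c).
HB.instance Definition _ c := GRing.isMonoidMorphism.Build (fps R) (fps R) (dil c)
  (dil_is_monoid_morphism c).

Lemma dilC c a : dil c (fpsC a) = fpsC a.
Proof. by apply: fpsP => -[|n] /=; rewrite ?expr0 ?mul1r ?mulr0. Qed.

Lemma dilX c : dil c fpsX = fpsX * fpsC c.
Proof.
apply: fpsP => n; rewrite mulrC fpsCM_coef /=.
by case: eqP => [->|_]; rewrite ?expr1 ?mulr0.
Qed.
End FpsCoef.

Section Rmorph.
Variables (R S : comNzRingType) (phi : {rmorphism R -> S}).
Variables (p : R) (ip ip2 w : nat -> R).
Lemma rmorph_msum h u x N :
  phi (msum p ip ip2 h u x N) =
  msum (phi p) (fun n => phi (ip n)) (fun n => phi (ip2 n)) h u (phi x) N.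
Proof.
elim: h N => [|h IH] N /=; rewrite rmorphM rmorphXn //; congr (_ * _).
rewrite /bailey rmorph_sum; apply: eq_bigr => M _.
by rewrite !rmorphM !rmorphXn IH.
Qed.

Lemma rmorph_psum h u M x :
  phi (psum p ip ip2 w h u M x) =
  psum (phi p) (fun n => phi (ip n)) (fun n => phi (ip2 n)) (fun n => phi (w n))
    h u M (phi x).
Proof.
rewrite rmorph_sum; apply: eq_bigr => N _.
by rewrite !rmorphM !rmorphXn rmorph_msum.
Qed.
End Rmorph.

(** * Removing the parts of size at most two *)

Local Open Scope nat_scope.

(* The condition on a = f_2, c = fbar_1 and d = f_1, for k = h + 2. *)
Definition small_parts_ok h i a c d :=
  (a + c < i) && ~~ [&& 0 < d, i == h.+2, c == 0 & h <= a].

(* A, B, C, D, W stand for t |-> f_(2t), fbar_(2t), fbar_(2t+1), f_(2t+1),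
   V_(2t+1); in the equality cases the weighted sums of (4) and (5) both equal
   t (k - 1) + f_(2t+2). *)
Definition reduced_cond (k i : nat) (A B C D W : nat -> nat) := forall t,
  [/\ C 0 + A 1 <= i - 1,
      A t + B t + C t + A t.+1 <= k - 1,
      1 <= D t -> A t.+1 <= k - 2,
      A t + B t + C t + A t.+1 = k - 1 ->
        t * (k - 1) + A t.+1 = W t + (i - 1) %[mod 2]
    & 1 <= D t -> A t.+1 = k - 2 ->
        t * (k - 1) + A t.+1 = W t + (i - 1) %[mod 2]].

Lemma O_condE k i l : 2 <= k -> O_cond k i l <->
  reduced_cond k i (fun t => f l (2 * t)) (fun t => fbar l (2 * t))
    (fun t => fbar l (2 * t + 1)) (fun t => f l (2 * t + 1)) (fun t => V l (2 * t + 1)).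
Proof.
move=> k2; split=> H t; have := H t; rewrite /= !(mulnS, addn0, muln0, add0n);
  rewrite !(addnC 2 (2 * t)) => -[h1 h2 h3 h4 h5]; split=> //.
- move=> e; rewrite -h4 //; congr (_ %% 2); rewrite -e; ring.
- move=> d e; rewrite -h5 //; congr (_ %% 2); have -> : k - 1 = (k - 2).+1 by lia.
  rewrite !e; ring.
- move=> e; rewrite -h4 //; congr (_ %% 2); rewrite -e; ring.
- move=> d e; rewrite -h5 //; congr (_ %% 2); have -> : k - 1 = (k - 2).+1 by lia.
  rewrite !e; ring.
Qed.

(** At t = 0, conditions (2) to (5) follow from (1) except when f_1 > 0, fbar_1 = 0, i = k and f_2
    >= k - 2, the case that [small_parts_ok] excludes. At t = 1, equality in (2) satisfies (4) only
    if e = 0, so (2) and (4) bound C' 0 + A' 1 by i' - 1. For t >= 1 the choice of e makes the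
    parity tests for i at t those for i' at t - 1. *)
Lemma reduced_cond_shift k i A B C D W A' B' C' D' W' :
  2 <= k -> 0 < i <= k -> A 0 = 0 -> B 0 = 0 -> A' 0 = 0 -> B' 0 = 0 ->
  (forall t, A t.+2 = A' t.+1) -> (forall t, B t.+2 = B' t.+1) ->
  (forall t, C t.+1 = C' t) -> (forall t, D t.+1 = D' t) ->
  W 0 = C 0 -> W' 0 = C' 0 -> (forall t, W t.+1 = B 1 + C 0 + W' t) -> C 0 <= 1 ->
  let i' := k - (A 1 + B 1 + odd (A 1 + C 0 + i).-1) in
  reduced_cond k i A B C D W <->
  [/\ small_parts_ok (k - 2) i (A 1) (C 0) (D 0), 0 < i' & reduced_cond k i' A' B' C' D' W'].
Proof.
move=> k2 ik A0 B0 A0' B0' hA hB hC hD W0 W0' hW C0 i'.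
set e := nat_of_bool (odd (A 1 + C 0 + i).-1) in i' *.
have e1 : e <= 1 by rewrite /e; case: odd.
have eE : (e = (A 1 + C 0 + (i - 1)) %% 2) by rewrite modn2 /e; congr (nat_of_bool (odd _)); lia.
have i'E : i' = k - (A 1 + B 1 + e) by [].
clearbody e i'.
split.
  move=> H; split.
  - by have [h1 h2 h3 h4 h5] := H 0; rewrite /small_parts_ok; lia.
  - by have [h1 h2 h3 h4 h5] := H 1; rewrite hC hW in h2 h4; lia.
  move=> t; have [h1 h2 h3 h4 h5] := H t.+1; have [g1 g2 g3 g4 g5] := H 1.
  rewrite mulSn in h4 h5.
  case: t h1 h2 h3 h4 h5 => [|t]; rewrite ?hA ?hB ?hC ?hD ?hW => h1 h2 h3 h4 h5;
   rewrite ?hA ?hB ?hC ?hD ?hW in g1 g2 g3 g4 g5; split; lia.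
move=> [ok i0 H] t; rewrite /small_parts_ok in ok.
have [h1 h2 h3 h4 h5] := H 0; rewrite W0' A0' B0' in h1 h2 h3 h4 h5.
have first : C 0 + A 1 <= i - 1 by lia.
(* The choice of [e] makes this sum even; s turns the congruences into linear equations. *)
have [s sE] : exists s, A 1 + C 0 + (i - 1) + e = s * 2.
  exists ((A 1 + C 0 + (i - 1) + e) %/ 2); clear -eE; lia.
clear eE.
case: t => [|[|t]]; rewrite ?hA ?hB ?hC ?hD ?hW.
- by rewrite A0 B0 W0; clear H h1 h2 h3 h4 h5 sE; split=> //; lia.
- rewrite mul1n W0'; clear H h2 h4 ok hA hB hC hD hW A0 B0 A0' B0'.
  have even_sum x z : (exists u, x + z = u * 2) -> x = z %[mod 2] by case=> u; lia.
  split=> //; first by clear even_sum h3 h5; lia.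
    move=> e4; apply: even_sum; exists (k - 1 - A 1 + s); clear h3 h5; lia.
  move=> d e5; apply: even_sum; exists (k - 1 + s - A 1 - e).
  have {}h5 := h5 d e5; have odd_sum : A 1 + B 1 + e + C' 0 = 1.
    by clear h3 first sE; lia.
  clear h3 h5; lia.
have [_ g2 g3 g4 g5] := H t.+1.
have {}eE : (k - 1 + (W' t.+1 + (i' - 1)) = B 1 + C 0 + W' t.+1 + (i - 1) %[mod 2]).
  rewrite -(modnMDl (B 1 + s) (k - 1 + _)) -(modnMDl (k - 1) (B 1 + _ + _ + _)).
  congr (_ %% 2); clear -i'E sE i0 first ik k2; lia.
rewrite mulSn; move: (t.+1 * (k - 1)) g4 g5 => T g4 g5.
clear -g2 g3 g4 g5 eE first.
split=> // [hs|d1 d2]; [have g := g4 hs|have g := g5 d1 d2];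
  by rewrite -addnA -modnDmr g modnDmr.
Qed.

(** * Gluing small parts to an overpartition and removing them *)

Definition part_ge (x y : nat * bool) : bool :=
  (y.1 < x.1) || ((y.1 == x.1) && (y.2 ==> x.2)).

Lemma part_ge_trans : transitive part_ge.
Proof. move=> [b bb] [a ab] [c cb]; rewrite /part_ge /=; move: ab bb cb => [] [] [] /=; lia. Qed.

Lemma part_ge_anti : antisymmetric part_ge.
Proof.
move=> [a ab] [b bb]; rewrite /part_ge /= => h.
have [eab ebb] : (a = b) /\ (ab = bb) by move: ab bb h => [] [] /=; lia.
by rewrite eab ebb.
Qed.

Lemma part_next_trans : transitive part_next.
Proof. move=> [b bb] [a ab] [c cb]; rewrite /part_next /=; move: ab bb cb => [] [] [] /=; lia. Qed.

(** [part_next] is not reflexive at overlined parts. For the order [part_ge] sorted lists are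
    determined by their multiplicities, and the ban on repeated overlined parts becomes a separate
    bound. *)
Lemma sorted_part_nextP l : sorted part_next l <->
  sorted part_ge l /\ forall t, fbar l t <= 1.
Proof.
split=> [sl|].
  split.
    apply: sub_sorted sl => -[a ab] [b bb]; rewrite /part_next /part_ge /=.
    by move: ab bb => [] [] /=; lia.
  move=> t; move: sl; rewrite (sorted_pairwise part_next_trans) /fbar.
  elim: l => //= -[a ab] l IH /andP[al /IH]; case: eqP => // -[ea eb] _.
  suff -> : count_mem (t, true) l = 0 by [].
  by apply/count_memPn/negP => /(allP al); rewrite /part_next /= ea ltnn andbF.
case; case: l => // x l; elim: l x => //= y l IH x /andP[xy yl] c.
rewrite IH ?andbT //; last first.
  by move=> t; apply: leq_trans (c t); rewrite /fbar /= leq_addl.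
move: xy (c x.1); case: x {c} => a ab; case: y {IH yl} => b bb.
rewrite /part_ge /part_next /fbar /= !xpair_eqE eqxx /=.
by case: ab; case: bb; case: (ltngtP b a) => //= _ _; lia.
Qed.

(** Here a, b, c, d are f_2, fbar_2, fbar_1, f_1 of the result; the blocks come in the order of
    [part_ge]. *)
Definition glue a b c d (l : seq (nat * bool)) : seq (nat * bool) :=
  [seq (x.1.+2, x.2) | x <- l] ++ nseq b (2, true) ++ nseq a (2, false)
  ++ nseq c (1, true) ++ nseq d (1, false).

Definition unglue (l : seq (nat * bool)) :=
  [seq (x.1 - 2, x.2) | x <- l & 2 < x.1].

Lemma size_glue a b c d l : size (glue a b c d l) = size l + (a + b + c + d).
Proof. rewrite !size_cat !size_nseq size_map; lia. Qed.

Lemma sumn_glue a b c d l : sumn [seq x.1 | x <- glue a b c d l] =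
  sumn [seq x.1 | x <- l] + (2 * size l + (2 * a + 2 * b + c + d)).
Proof.
rewrite !map_cat !sumn_cat !map_nseq !sumn_nseq /= -map_comp.
have -> : sumn [seq ((fun x => x.1) \o (fun x : nat * bool => (x.1.+2, x.2))) i | i <- l]
   = sumn [seq x.1 | x <- l] + 2 * size l.
  by elim: l => //= x l ->; lia.
lia.
Qed.

Lemma count_mem_shift (s : nat) (ov : bool) (l : seq (nat * bool)) :
  count_mem (s, ov) [seq (x.1.+2, x.2) | x <- l] =
  if s is t.+2 then count_mem (t, ov) l else 0.
Proof.
rewrite count_map; case: s => [|[|t]]; last by apply: eq_count => -[u v].
  by rewrite (eq_count (a2 := pred0)) ?count_pred0 // => -[u v].
by rewrite (eq_count (a2 := pred0)) ?count_pred0 // => -[u v].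
Qed.

Lemma count_glue a b c d (s : nat) (ov : bool) (l : seq (nat * bool)) :
  (forall ov : bool, count_mem (0, ov) l = 0) ->
  count_mem (s, ov) (glue a b c d l) =
  match s with
  | 0 => 0
  | 1 => if ov then c else d
  | 2 => if ov then b else a
  | s'.+2 => count_mem (s', ov) l
  end.
Proof.
move=> l0; rewrite !count_cat !count_nseq count_mem_shift /= !xpair_eqE.
by case: s => [|[|[|s]]] /=; case: ov; rewrite ?l0 /=; lia.
Qed.

Lemma positive_count (l : seq (nat * bool)) (ov : bool) :
  all (fun x => 0 < x.1) l -> count_mem (0, ov) l = 0.
Proof. by move=> pl; apply/count_memPn/negP => /(allP pl). Qed.

Lemma pairwise_nseq (T : Type) (r : rel T) n x : r x x -> pairwise r (nseq n x).
Proof. by move=> rx; elim: n => //= n ->; rewrite all_nseq rx orbT. Qed.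

Lemma sorted_glue a b c d l : all (fun x => 0 < x.1) l -> sorted part_ge l ->
  sorted part_ge (glue a b c d l).
Proof.
move=> pl; rewrite !(sorted_pairwise part_ge_trans) !pairwise_cat => sl.
rewrite !pairwise_nseq // pairwise_map [pairwise _ l]sl !allrel_catr.
have nn s t (x y : nat * bool) : part_ge x y -> allrel part_ge (nseq s x) (nseq t y).
  move=> xy; apply/allrelP => u v; rewrite !mem_nseq.
  by move=> /andP[_ /eqP->] /andP[_ /eqP->].
have ln t y : y.1 <= 2 -> allrel part_ge [seq (x.1.+2, x.2) | x <- l] (nseq t y).
  move=> y2; apply/allrelP => u v; rewrite mem_nseq.
  by move=> /mapP[x /(allP pl) x0 ->] /andP[_ /eqP->]; rewrite /part_ge /=; lia.
by rewrite !nn ?ln.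
Qed.

Lemma glue_overpartition a b c d n l : b <= 1 -> c <= 1 -> is_overpartition n l ->
  is_overpartition (n + (2 * size l + (2 * a + 2 * b + c + d))) (glue a b c d l).
Proof.
move=> b1 c1 /and3P[/sorted_part_nextP[sl fl] pl /eqP nl].
apply/and3P; split; last by rewrite sumn_glue nl.
  apply/sorted_part_nextP; split=> [|t]; first exact: sorted_glue.
  rewrite /fbar count_glue //; last by move=> ov; apply: positive_count.
  by case: t => [|[|[|t]]] //; apply: fl.
by rewrite !all_cat !all_nseq /= !orbT !andbT all_map; apply/allP.
Qed.

Lemma count_unglue s ov l : count_mem (s.+1, ov) (unglue l) = count_mem (s.+3, ov) l.
Proof.
rewrite count_map count_filter; apply: eq_count => -[u v] /=.
rewrite !xpair_eqE; lia.
Qed.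

Lemma unglue_positive l : all (fun x => 0 < x.1) (unglue l).
Proof. by rewrite all_map all_filter; apply/allP => -[u v] _ /=; lia. Qed.

Lemma unglue_sorted l : sorted part_ge l -> sorted part_ge (unglue l).
Proof.
rewrite !(sorted_pairwise part_ge_trans) pairwise_map => sl.
have := pairwise_filter (fun x => 2 < x.1) sl.
apply: (@sub_in_pairwise _ (fun x => 2 < x.1)); last exact: filter_all.
by move=> [u v] [s t]; rewrite !unfold_in /part_ge /=; lia.
Qed.

Lemma unglue_overpartition n l : is_overpartition n l ->
  is_overpartition (sumn [seq x.1 | x <- unglue l]) (unglue l).
Proof.
move=> /and3P[/sorted_part_nextP[sl fl] pl _]; apply/and3P; split=> //.
  apply/sorted_part_nextP; split=> [|[|t]]; first exact: unglue_sorted.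
    by rewrite /fbar positive_count // unglue_positive.
  by rewrite /fbar count_unglue; apply: fl.
exact: unglue_positive.
Qed.

Lemma glue_unglue n l : is_overpartition n l ->
  l = glue (f l 2) (fbar l 2) (fbar l 1) (f l 1) (unglue l).
Proof.
move=> /and3P[/sorted_part_nextP[sl fl] pl _].
apply: (sorted_eq part_ge_trans part_ge_anti) => //.
  by apply: sorted_glue; [apply: unglue_positive|apply: unglue_sorted].
apply/allP => -[s ov] _; apply/eqP; rewrite /= count_glue; last first.
  by move=> ov'; apply/positive_count/unglue_positive.
case: s => [|[|[|s]]]; first exact: positive_count.
- by case: ov.
- by case: ov.
by rewrite count_unglue.
Qed.

Lemma unglue_glue a b c d l : all (fun x => 0 < x.1) l ->
  unglue (glue a b c d l) = l.
Proof.
move=> pl; rewrite /unglue /glue !filter_cat !map_cat.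
rewrite (_ : filter _ (nseq b _) = [::]); last by elim: b.
rewrite (_ : filter _ (nseq a _) = [::]); last by elim: a.
rewrite (_ : filter _ (nseq c _) = [::]); last by elim: c.
rewrite (_ : filter _ (nseq d _) = [::]); last by elim: d.
rewrite !cats0 filter_map -map_comp.
rewrite (_ : filter _ l = l); last first.
  by apply/all_filterP/allP => x /(allP pl) /=; lia.
by rewrite -[RHS]map_id; apply: eq_map => -[u v] /=; rewrite subn2.
Qed.

Lemma V_glue a b c d l s : V (glue a b c d l) s.+2 = b + c + V l s.
Proof.
rewrite /V !count_cat !count_nseq count_map /= addnC; congr (_ + _); lia.
Qed.

Lemma V_glue1 a b c d l : all (fun x => 0 < x.1) l -> V (glue a b c d l) 1 = c.
Proof.
move=> pl; rewrite /V !count_cat !count_nseq count_map /=.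
rewrite (_ : count _ l = 0); first by lia.
by apply/eqP; rewrite -leqn0 leqNgt -has_count; apply/hasPn => x /=; rewrite andbF.
Qed.

Lemma V1 l : all (fun x => 0 < x.1) l -> V l 1 = fbar l 1.
Proof.
move=> pl; apply: eq_in_count => -[s ov] /(allP pl) /= s0.
by rewrite xpair_eqE; case: ov; lia.
Qed.

Lemma O_cond_glue k i a b c d l : 2 <= k -> 0 < i <= k -> c <= 1 ->
  all (fun x => 0 < x.1) l ->
  let i' := k - (a + b + odd (a + c + i).-1) in
  O_cond k i (glue a b c d l) <->
  [/\ small_parts_ok (k - 2) i a c d, 0 < i' & O_cond k i' l].
Proof.
move=> k2 ik c1 pl i'; rewrite !(propext (O_condE _ _ k2)).
have l0 ov := positive_count ov pl.
have F s : f (glue a b c d l) s = match s with 0 => 0 | 1 => d | 2 => a | s'.+2 => f l s' end.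
  by rewrite /f count_glue.
have G s : fbar (glue a b c d l) s = match s with 0 => 0 | 1 => c | 2 => b | s'.+2 => fbar l s' end.
  by rewrite /fbar count_glue.
have e2 t : 2 * t.+2 = (2 * t.+1).+2 by lia.
have e1 t : 2 * t.+1 + 1 = (2 * t + 1).+2 by lia.
have e3 t : 2 * t.+1 = (2 * t).+2 by lia.
have := @reduced_cond_shift k i (fun t => f (glue a b c d l) (2 * t))
  (fun t => fbar (glue a b c d l) (2 * t)) (fun t => fbar (glue a b c d l) (2 * t + 1))
  (fun t => f (glue a b c d l) (2 * t + 1)) (fun t => V (glue a b c d l) (2 * t + 1))
  (fun t => f l (2 * t)) (fun t => fbar l (2 * t)) (fun t => fbar l (2 * t + 1))
  (fun t => f l (2 * t + 1)) (fun t => V l (2 * t + 1)) k2 ik.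
rewrite /= !muln0 !muln1 !add0n !F !G /=; apply => //; rewrite ?V_glue1 ?V1 //.
- by rewrite /f l0.
- by rewrite /fbar l0.
- by move=> t; rewrite e2 F e3.
- by move=> t; rewrite e2 G e3.
- by move=> t; rewrite e1 G addn1.
- by move=> t; rewrite e1 F addn1.
- by move=> t; rewrite e1 V_glue.
Qed.

(** Plain sequences are used because gluing changes the length and the bound on the parts, both of
    which are fixed in the type of the tuples. *)
Definition O_list k i m n : seq (seq (nat * bool)) :=
  [seq [seq (val x.1, x.2) | x <- tval l] |
     l <- enum [set l : m.-tuple ('I_n.+1 * bool) |
      let l' := [seq (val x.1, x.2) | x <- l] in
      is_overpartition n l' && `[< O_cond k i l' >]]].

Lemma size_O_list k i m n : size (O_list k i m n) = Otilde k i m n.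
Proof. by rewrite size_map -cardE. Qed.

Lemma O_list_uniq k i m n : uniq (O_list k i m n).
Proof.
rewrite map_inj_uniq ?enum_uniq // => s t st; apply/val_inj.
by apply: inj_map st => -[u b] [v c] [/val_inj -> ->].
Qed.

Lemma leq_sumn (s : seq nat) x : x \in s -> x <= sumn s.
Proof. by elim: s => //= y s IH; rewrite inE => /orP[/eqP->|/IH]; lia. Qed.

Lemma mem_O_list k i m n l : l \in O_list k i m n <->
  [/\ size l = m, is_overpartition n l & O_cond k i l].
Proof.
split=> [/mapP[t]|[sl ol cl]].
  rewrite mem_enum inE => /andP[ot /asboolP ct] ->; split => //.
  by rewrite size_map size_tuple.
have s : size [seq (inord x.1 : 'I_n.+1, x.2) | x <- l] == m by rewrite size_map sl.
have E : [seq (val x.1, x.2) | x <- Tuple s] = l.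
  rewrite -map_comp -[RHS]map_id; apply/eq_in_map => -[u b] ul /=.
  rewrite inordK // ltnS; move: ol => /and3P[_ _ /eqP <-].
  by apply: leq_sumn; apply/mapP; exists (u, b).
apply/mapP; exists (Tuple s) => //.
rewrite mem_enum inE; cbv zeta; rewrite E ol.
by apply/asboolP.
Qed.

Lemma fbar_le1 n l t : is_overpartition n l -> fbar l t <= 1.
Proof. by case/and3P=> /sorted_part_nextP[]. Qed.

(** [e] holds the multiplicities of the parts 1 and 2, where a < k because f_2 < i <= k. The amount
    n' comes from these parts and from lowering the m' others by 2. *)
Definition O_rest k i m n (e : 'I_m.+1 * ('I_k * ('I_2 * 'I_2))) :=
  let: (d, (a, (b, c))) := e in
  let i' := k - (a + b + odd (a + c + i).-1) in
  let m' := m - (a + b + c + d) in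
  let n' := 2 * a + 2 * b + c + d + 2 * m' in
  if [&& small_parts_ok (k - 2) i a c d, 0 < i', a + b + c + d <= m & n' <= n]
  then O_list k i' m' (n - n') else [::].

Definition O_glue k m (e : 'I_m.+1 * ('I_k * ('I_2 * 'I_2))) l :=
  glue e.2.1 e.2.2.1 e.2.2.2 e.1 l.

Lemma O_list_glue k i m n : 2 <= k -> 0 < i <= k ->
  perm_eq (O_list k i m n)
    [seq O_glue e l | e <- enum {: 'I_m.+1 * ('I_k * ('I_2 * 'I_2))},
       l <- O_rest i n e].
Proof.
move=> k2 ik; apply: uniq_perm; first exact: O_list_uniq.
  apply: allpairs_uniq_dep; first exact: enum_uniq.
    move=> [d [a [b c]]] _ /=; case: ifP => // _; exact: O_list_uniq.
  move=> u v /allpairsPdep[[d [a [b c]]] [l [_ Hl ->]]].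
  move=> /allpairsPdep[[d' [a' [b' c']]] [l' [_ Hl' ->]]] /=.
  have pos (e : 'I_m.+1 * ('I_k * ('I_2 * 'I_2))) s :
      s \in O_rest i n e -> all (fun x => 0 < x.1) s.
    case: e => [? [? [? ?]]] /=; case: ifP => // _ /mem_O_list[_ + _].
    by case/and3P.
  rewrite /O_glue /= => E.
  have c0 (s : seq (nat * bool)) ov : all (fun x => 0 < x.1) s -> count_mem (0, ov) s = 0.
    exact: positive_count.
  have C s ov := congr1 (count_mem (s, ov)) E.
  have El := congr1 unglue E; rewrite !unglue_glue ?(pos _ _ Hl) ?(pos _ _ Hl') // in El.
  (* The counts of the parts 1 and 2 give back c, d, b, a, so the decomposition is unique. *)
  have := C 1 true; have := C 1 false; have := C 2 true; have := C 2 false.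
  rewrite !count_glue; try by move=> ov; apply: c0; first [exact: pos Hl | exact: pos Hl'].
  by do 4!move/val_inj->; rewrite El.
move=> l; apply/idP/allpairsPdep => [/mem_O_list[sl ol cl]|].
  have gl := glue_unglue ol; have ol' := unglue_overpartition ol.
  set l' := unglue l in gl ol'.
  have b1 : fbar l 2 < 2 := fbar_le1 2 ol.
  have c1 : fbar l 1 < 2 := fbar_le1 1 ol.
  have pl : all (fun x => 0 < x.1) l' := unglue_positive l.
  clearbody l'.
  rewrite gl in cl; case/(@O_cond_glue _ _ _ _ _ _ _ k2 ik c1 pl): (cl) => ok i0 cl'.
  have am : f l 2 < k by move: ok; rewrite /small_parts_ok; lia.
  have dm : f l 1 < m.+1 by rewrite ltnS -sl count_size.
  exists (Ordinal dm, (Ordinal am, (Ordinal b1, Ordinal c1))), l'; split=> //.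
    by rewrite mem_enum.
  have sz := congr1 size gl; rewrite size_glue sl in sz.
  have sm := congr1 (fun l => sumn [seq x.1 | x <- l]) gl; rewrite /= sumn_glue in sm.
  have nE : sumn [seq x.1 | x <- l] = n by move: ol => /and3P[_ _ /eqP].
  rewrite nE in sm; move: sz sm ol'.
  move: (sumn [seq x.1 | x <- l']) => u sz sm ol'.
  rewrite /= ok i0 /= ifT; last by lia.
  apply/mem_O_list; split=> //; first by rewrite sz addnK.
  by rewrite (_ : n - _ = u) //; lia.
case=> -[d [a [b c]]] [l' [_ /= H ->]]; move: H; case: ifP => //.
case/and4P=> ok i0 sm sn /mem_O_list[sl ol cl].
have pl : all (fun x => 0 < x.1) l' by case/and3P: ol.
apply/mem_O_list; split; first by rewrite size_glue sl subnK.
  have := glue_overpartition a d (ltn_ord b : b <= 1) (ltn_ord c : c <= 1) ol.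
  by rewrite sl; congr (is_overpartition _ _); lia.
by apply/(@O_cond_glue _ _ _ _ _ _ _ k2 ik _ pl) => //; apply: (ltn_ord c).
Qed.

Lemma Otilde_rec k i m n : 2 <= k -> 0 < i <= k ->
  Otilde k i m n =
  \sum_(d < m.+1) \sum_(a < k) \sum_(b < 2) \sum_(c < 2)
    let i' := k - (a + b + odd (a + c + i).-1) in
    let m' := m - (a + b + c + d) in
    let n' := 2 * a + 2 * b + c + d + 2 * m' in
    if [&& small_parts_ok (k - 2) i a c d, 0 < i', a + b + c + d <= m & n' <= n]
    then Otilde k i' m' (n - n') else 0.
Proof.
move=> k2 ik; rewrite -size_O_list (perm_size (O_list_glue m n k2 ik)).
rewrite size_allpairs_dep sumnE big_map big_enum /=.
under [RHS]eq_bigr => d _ do (under eq_bigr => a _ do rewrite pair_bigA; rewrite pair_bigA).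
rewrite pair_bigA; apply: eq_bigr => -[d [a [b c]]] _ /=.
by case: ifP => // _; rewrite size_O_list.
Qed.

Lemma Otilde_empty k i n : 2 <= k -> 0 < i <= k -> Otilde k i 0 n = (n == 0).
Proof.
move=> k2 ik; rewrite -size_O_list.
have [->|n0] := eqVneq n 0; last first.
  apply/eqP; rewrite size_eq0; case E: (O_list _ _ _ _) => [//|l s].
  have : l \in O_list k i 0 n by rewrite E mem_head.
  by case/mem_O_list => /size0nil -> /and3P[_ _]; rewrite /= eq_sym (negbTE n0).
rewrite (@perm_size _ _ [:: [::]]) //; apply: uniq_perm => //; first exact: O_list_uniq.
move=> l; rewrite inE; apply/idP/eqP => [/mem_O_list[/size0nil]//|->].
apply/mem_O_list; split=> // t; rewrite /f /fbar /V /=; split=> //; try lia.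
all: move=> *; lia.
Qed.

(** * Functional equations of the multisum *)

Local Open Scope ring_scope.

Section Series.
Variables (S : comNzRingType) (q : S) (ip ip2 w : nat -> S).
Let p := q * q.
Hypothesis ipS : forall n, ip n = ip n.+1 * (1 - p ^+ n.+1).
Hypothesis ip2S : forall n, ip2 n = ip2 n.+1 * (1 - p ^+ (2 * n.+1)).
Hypothesis wS : forall n, w n.+1 = w n * (q * (1 + p ^+ n) * (1 + q * p ^+ n)).
Variable h : nat.

Local Notation x := (fpsX : fps S).
Local Notation psumX u M t := (psum (fpsC p) (fun n => fpsC (ip n)) (fun n => fpsC (ip2 n))
  (fun n => fpsC (w n)) h u M t).

(* The N-th term is divisible by x^N, so m + 1 terms determine the coefficient of x^m. *)
Definition Eser u : fps S := Fps (fun m => psumX u m.+1 x m).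

Lemma Eser_approx u M : exists r, Eser u = psumX u M x + x ^+ M * r.
Proof.
suff E m N : (m < N)%N -> Eser u m = psumX u N x m.
  have [|r rE] := @fps_divXn _ M (Eser u - psumX u M x).
    by move=> m mM; rewrite fpsBE (E _ M) // subrr.
  by exists r; rewrite -rE addrC subrK.
move=> mN; rewrite -(subnKC mN) /=; elim: (N - m.+1)%N => [|t ->]; first by rewrite addn0.
rewrite addnS [in RHS]/psum big_ord_recr fpsDE mulrAC [X in _ = _ + fcoef X _]mulrC fpsXnM_coef.
have -> : (m < m.+1 + t)%N by lia.
by rewrite addr0.
Qed.

(* The multisum with parameter i for 0 < i < k = h + 2; the values 0 at i = 0
   and F_(k-1) at i = k are those that the functional equations force. *)
Definition Fser i : fps S :=
  if i == 0%N then 0 else let j := minn i h.+1 in Eser (h.+2 - j)%N + Eser (h.+1 - j)%N.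

Local Notation y := (x * fpsC p).
Local Notation z := (x * fpsC q).
Local Notation D := (dil p).

Lemma dil_Eser_approx u M : exists r, D (Eser u) = psumX u M y + x ^+ M * r.
Proof.
have [r ->] := Eser_approx u M; rewrite rmorphD rmorphM rmorphXn /= rmorph_psum /= dilX.
exists (fpsC p ^+ M * D r); rewrite exprMn mulrA; congr (_ + _).
by rewrite dilC; congr (psum _ _ _ _ _ _ _ _); apply/boolp.funext => n; rewrite dilC.
Qed.

(** Passes from truncated sums, equal modulo every x^M, to the full series. *)
Lemma fps_eq_mod (f g : fps S) :
  (forall M, exists r, f = g + x ^+ M * r) -> f = g.
Proof.
move=> fg; apply: fpsP => n; have [r ->] := fg n.+1.
by rewrite fpsDE fpsXnM_coef ltnSn addr0.
Qed.

Let ipS' n : fpsC (ip n) = fpsC (ip n.+1) * (1 - fpsC p ^+ n.+1).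
Proof. by rewrite ipS rmorphM rmorphB rmorphXn rmorph1. Qed.
Let ip2S' n : fpsC (ip2 n) = fpsC (ip2 n.+1) * (1 - fpsC p ^+ (2 * n.+1)).
Proof. by rewrite ip2S rmorphM rmorphB rmorphXn rmorph1. Qed.
Let wS' n : fpsC (w n.+1) = fpsC (w n) * (fpsC q * (1 + fpsC p ^+ n) * (1 + fpsC q * fpsC p ^+ n)).
Proof. by rewrite wS !(rmorphM, rmorphD, rmorphXn, rmorph1). Qed.

Lemma Eser_diff e : (e < h)%N ->
  (1 - z) * (Eser (h - e).-1 - Eser (h - e).+1) =
  (1 + y) * y ^+ e * (y * (D (Eser e.+2) + D (Eser e.+1))
                      + z * (D (Eser e.+1) + D (Eser e))).
Proof.
move=> eh; apply: fps_eq_mod => M.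
have [r1 ->] := Eser_approx (h - e).-1 M.
have [r2 ->] := Eser_approx (h - e).+1 M.
have [r3 ->] := dil_Eser_approx e.+2 M.
have [r4 ->] := dil_Eser_approx e.+1 M.
have [r5 ->] := dil_Eser_approx e M.
have [r] := psum_diff ipS' ip2S' (rmorphM _ _ _) wS' x M eh.
set c := _ * y ^+ e => /(congr1 (fun t => t + x ^+ M * ((1 - z) * (r1 - r2)))) E.
exists (r + (1 - z) * (r1 - r2) - c * (y * (r3 + r4) + z * (r4 + r5))).
rewrite (_ : _ * _ = (1 - z) * (psumX (h - e).-1 M x - psumX (h - e).+1 M x)
  + x ^+ M * ((1 - z) * (r1 - r2))); last by ring.
rewrite {}E; ring.
Qed.

Lemma Eser_first : (1 - z) * (Eser h.+1 + Eser h) = (1 + y) * (D (Eser 1) + D (Eser 0)).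
Proof.
apply: fps_eq_mod => M.
have [r1 ->] := Eser_approx h.+1 M.
have [r2 ->] := Eser_approx h M.
have [r3 ->] := dil_Eser_approx 1 M.
have [r4 ->] := dil_Eser_approx 0 M.
have [r] := psum_first ipS' ip2S' (rmorphM _ _ _) wS' h x M.
move => /(congr1 (fun t => t + x ^+ M * ((1 - z) * (r1 + r2)))) E.
exists (r + (1 - z) * (r1 + r2) - (1 + y) * (r3 + r4)).
rewrite (_ : _ * _ = (1 - z) * (psumX h.+1 M x + psumX h M x)
  + x ^+ M * ((1 - z) * (r1 + r2))); last by ring.
rewrite {}E; ring.
Qed.

Lemma Fser0 : Fser 0 = 0. Proof. by []. Qed.

Lemma Fser_mid i : (0 < i <= h.+1)%N ->
  Fser i = Eser (h.+2 - i)%N + Eser (h.+1 - i)%N.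
Proof.
by case/andP=> i0 ih; rewrite /Fser gtn_eqF // (minn_idPl ih).
Qed.

Lemma Fser_last : Fser h.+2 = Fser h.+1.
Proof. by rewrite /Fser /= minnn (minn_idPr (leqnSn _)). Qed.

Lemma Fser_first : (1 - z) * Fser 1 = (1 + y) * D (Fser h.+1).
Proof.
by rewrite !Fser_mid ?ltnS ?leqnn // subn1 subSnn subnn rmorphD -Eser_first !subSS subn0.
Qed.

Lemma Fser_diff e : (e < h)%N ->
  (1 - z) * (Fser e.+2 - Fser e.+1) =
  (1 + y) * y ^+ e * (y * D (Fser (h - e)%N) + z * D (Fser (h - e).+1)).
Proof.
move=> eh; rewrite !Fser_mid; try lia.
have -> : (h.+2 - (h - e) = e.+2)%N by lia.
have -> : (h.+1 - (h - e) = e.+1)%N by lia.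
have -> : (h.+2 - (h - e).+1 = e.+1)%N by lia.
have -> : (h.+1 - (h - e).+1 = e)%N by lia.
have -> : (h.+2 - e.+2 = h - e)%N by lia.
have -> : (h.+1 - e.+2 = (h - e).-1)%N by lia.
have -> : (h.+2 - e.+1 = (h - e).+1)%N by lia.
have -> : (h.+1 - e.+1 = h - e)%N by lia.
rewrite ![D (_ + _)]rmorphD -Eser_diff //; ring.
Qed.

(** The contribution of f_2 = a, without y^a, summed over fbar_2 = 0, 1; [d] is the parity bit in
    i'. *)
Let K (d : bool) a :=
  D (Fser (h.+2 - (a + d))%N) + y * D (Fser (h.+2 - (a + d).+1)%N).

(** The sum over f_2, fbar_2 and fbar_1 with f_2 + fbar_1 < i; its two lines are fbar_1 = 0 and
    fbar_1 = 1. *)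
Definition small_parts_sum i :=
  \sum_(a < i) y ^+ a * K (odd (a + i).-1) a
  + z * \sum_(a < i.-1) y ^+ a * K (odd (a + i)%N) a.

(** Raising i by 2 preserves the parity bits, so only the top two values of a in each sum are
    new. *)
Lemma small_parts_sum_rec i : small_parts_sum i.+3 = small_parts_sum i.+1
  + y ^+ i.+1 * (K true i.+1 + y * K false i.+2)
  + z * y ^+ i * (K true i + y * K false i.+1).
Proof.
rewrite /small_parts_sum !big_ord_recr /=.
have odd2 (n : nat) : odd (n + n) = false by rewrite addnn odd_double.
have -> : odd (i + i.+3)%N = true by rewrite !addnS /= odd2.
have -> : odd (i + i.+3).-1 = odd (i + i.+1).-1 by rewrite !addnS /= negbK.
have e1 : \sum_(a < i) y ^+ a * K (odd (a + i.+3).-1) a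
        = \sum_(a < i) y ^+ a * K (odd (a + i.+1).-1) a.
  by apply: eq_bigr => a _; rewrite !addnS /= negbK.
have e2 : \sum_(a < i) y ^+ a * K (odd (a + i.+3)%N) a
        = \sum_(a < i) y ^+ a * K (odd (a + i.+1)%N) a.
  by apply: eq_bigr => a _; rewrite !addnS /= negbK.
rewrite e1 e2 /= !exprS; ring.
Qed.

(** The parity bits have period 2 in i, so the induction carries two consecutive values and adds two
    instances of [Fser_diff]. *)
Lemma Fser_rec2 i : (i.+1 <= h)%N ->
  (1 - z) * Fser i.+1 = small_parts_sum i.+1 /\ (1 - z) * Fser i.+2 = small_parts_sum i.+2.
Proof.
elim: i => [|i IH] ih.
  (* The two terms of [K false 0] merge by the convention F_k = F_(k-1). *)
  have D1 : (1 - z) * Fser 1 = small_parts_sum 1.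
    rewrite Fser_first /small_parts_sum /= big_ord1 big_ord0 /K /= addn0 subn0 subn1 /=.
    by rewrite Fser_last; ring.
  split => //; have := Fser_diff ih; rewrite mulrBr D1 => /eqP.
  rewrite subr_eq => /eqP ->.
  rewrite /small_parts_sum /= !big_ord_recr !big_ord0 /K /= !addn0 !subn0 !addn1 !subSS !subn0.
  by rewrite Fser_last; ring.
have [E1 E2] := IH (ltnW ih); split => //.
have ih' : (i < h)%N by lia.
have := Fser_diff ih; have := Fser_diff ih'.
rewrite small_parts_sum_rec -E1 !mulrBr => /eqP; rewrite subr_eq => /eqP e1.
move=> /eqP; rewrite subr_eq => /eqP ->.
rewrite e1 {E1 E2 e1} /K /= !addn0 !addn1 !subSS !exprS.
have -> : (h.+1 - i = (h - i).+1)%N by lia.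
have -> : (h - i = (h - i.+1).+1)%N by lia.
ring.
Qed.

Lemma Fser_rec i : (0 < i <= h.+1)%N -> (1 - z) * Fser i = small_parts_sum i.
Proof.
case: i => [|[|i]] // ih; last by have [] := @Fser_rec2 i; first lia.
rewrite Fser_first /small_parts_sum /= big_ord1 big_ord0 /K /= addn0 subn0 subn1 /=.
by rewrite Fser_last; ring.
Qed.

(** The subtracted term is z times the weight of the configurations forbidden when f_1 > 0, as
    [box_last] shows. For h > 0, one instance of [Fser_diff] supplies everything that
    [small_parts_sum_rec] adds except this term. *)
Lemma Fser_rec_last :
  (1 - z) * Fser h.+2 = small_parts_sum h.+2 - z * (1 + y) * y ^+ h * D (Fser 1).
Proof.
rewrite Fser_last; case: (posnP h) => [h0|].
  have F1 : Fser h.+1 = Fser 1 by rewrite h0.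
  have F2 : Fser 2 = Fser 1 by rewrite -F1 -Fser_last h0.
  rewrite F1 Fser_first F1 h0 /small_parts_sum !big_ord_recr !big_ord0 /K h0 /= F2 /=.
  by rewrite Fser0 rmorph0; ring.
case E: h => [|h'] // _.
have h'h : (h' < h)%N by lia.
have := Fser_diff h'h.
rewrite mulrBr [in (1 - z) * Fser h'.+1]Fser_rec; last by lia.
move=> /eqP; rewrite subr_eq => /eqP ->.
rewrite small_parts_sum_rec /K /= !addn0 !addn1 E !subSS subnn subSn // subnn.
have -> : (h'.+2 - h' = 2)%N by lia.
by rewrite Fser0 rmorph0 !exprS; ring.
Qed.

Let T i a b c := z ^+ c * y ^+ (a + b) *
  D (Fser (h.+2 - (a + b + odd (a + c + i).-1))%N).

Let box i (P : nat -> nat -> bool) :=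
  \sum_(a < h.+2) \sum_(b < 2) \sum_(c < 2) if P a c then T i a b c else 0.

Lemma small_parts_sum_box i : (i <= h.+2)%N -> box i (fun a c => a + c < i)%N = small_parts_sum i.
Proof.
move=> ih; transitivity (\sum_(a < h.+2) (if (a < i)%N then y ^+ a * K (odd (a + i).-1) a else 0)
   + z * \sum_(a < h.+2) (if (a < i.-1)%N then y ^+ a * K (odd (a + i)%N) a else 0)).
  rewrite mulr_sumr -big_split; apply: eq_bigr => a _.
  rewrite !big_ord_recr !big_ord0 /= !add0r /T /K !addn0 !addn1 /=.
  have -> : (a.+1 < i)%N = (a < i.-1)%N by lia.
  rewrite !exprS !expr0 !addSn.
  by case: ifP; case: ifP => _ _; ring.
rewrite /small_parts_sum (big_ord_widen h.+2 (fun a => y ^+ a * K (odd (a + i).-1) a) ih).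
rewrite (big_ord_widen h.+2 (fun a => y ^+ a * K (odd (a + i)%N) a)); last by lia.
by rewrite -!big_mkcond.
Qed.

(** Only a = h and a = h + 1 remain; in both cases a plus its parity bit is h + 1, so b = 0 gives
    F_1 and b = 1 gives F_0 = 0. *)
Lemma box_last : box h.+2 (fun a c => (c == 0) && (h <= a))%N = (1 + y) * y ^+ h * D (Fser 1).
Proof.
rewrite /box !big_ord_recr !big_ord0 /= big1 => [|a _]; last first.
  by rewrite big1 // => b _; rewrite big1 // => c _; rewrite leqNgt ltn_ord andbF.
rewrite /= leqnn leqnSn /T !addn0 !addn1 /=.
rewrite !addnS !addSn /= !addnn odd_double /= !addn0 !addn1 !subSS subnn subSnn.
rewrite Fser0 rmorph0 !exprS.
by ring.
Qed.

(** Division by 1 - z becomes a truncated geometric sum, whose term z^d stands for d parts equal to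
    1. *)
Lemma Fser_box i M : (0 < i <= h.+2)%N -> exists r, Fser i =
  \sum_(d < M) \sum_(a < h.+2) \sum_(b < 2) \sum_(c < 2)
     (if small_parts_ok h i a c d then
        x ^+ (a + b + c + d) * (fpsC (q ^+ (2 * a + 2 * b + c + d)) *
        D (Fser (h.+2 - (a + b + odd (a + c + i).-1))%N)) else 0) + x ^+ M * r.
Proof.
move=> ih.
have E0 : \sum_(d < M) z ^+ d * box i (fun a c => small_parts_ok h i a c d) =
  \sum_(d < M) \sum_(a < h.+2) \sum_(b < 2) \sum_(c < 2)
     (if small_parts_ok h i a c d then
        x ^+ (a + b + c + d) * (fpsC (q ^+ (2 * a + 2 * b + c + d)) *
        D (Fser (h.+2 - (a + b + odd (a + c + i).-1))%N)) else 0).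
  apply: eq_bigr => d _; rewrite mulr_sumr; apply: eq_bigr => a _.
  rewrite mulr_sumr; apply: eq_bigr => b _; rewrite mulr_sumr; apply: eq_bigr => c _.
  case: ifP => _; last by rewrite mulr0.
  rewrite /T rmorphXn /= /p rmorphM /= !exprMn !exprD; ring.
rewrite -E0 {E0}.
have geo : (1 - z) * \sum_(d < M) z ^+ d = 1 - z ^+ M.
  by rewrite -[1 - z]opprB mulNr -subrX1 opprB.
have [ik|ik] := eqVneq i h.+2; last first.
  exists (fpsC q ^+ M * Fser i).
  have -> : \sum_(d < M) z ^+ d * box i (fun a c => small_parts_ok h i a c d)
         = (\sum_(d < M) z ^+ d) * small_parts_sum i.
    rewrite mulr_suml; apply: eq_bigr => d _; rewrite -small_parts_sum_box; last by lia.
    congr (_ * _); apply: eq_bigr => a _; apply: eq_bigr => b _; apply: eq_bigr => c _.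
    by rewrite /small_parts_ok (negbTE ik) andbF andbT.
  rewrite -Fser_rec; last by move: ik ih; lia.
  by rewrite mulrA -exprMn mulrCA [(1 - z) * _]mulrA geo; ring.
(* For i = k the extra restriction applies only if d > 0, so the term d = 0 is split off: with S for
   [small_parts_sum i], (S - z C)/(1 - z) = S + z (S - C)/(1 - z). *)
case: M geo => [|M] _; first by exists (Fser i); rewrite big_ord0 add0r mul1r.
set G := \sum_(d < M) z ^+ d.
have geo : z ^+ M = 1 - (1 - z) * G.
  by rewrite /G -[1 - z]opprB mulNr -subrX1 opprK addrC subrK.
set C := (1 + y) * y ^+ h * D (Fser 1).
exists (fpsC q ^+ M.+1 * (Fser i - C)).
rewrite mulrA -exprMn exprS geo.
have -> : \sum_(d < M.+1) z ^+ d * box i (fun a c => small_parts_ok h i a c d)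
       = small_parts_sum i + z * G * (small_parts_sum i - C).
  rewrite big_ord_recl expr0 mul1r mulr_sumr mulr_suml -small_parts_sum_box; last by lia.
  congr (_ + _).
    by do 3!apply: eq_bigr => ? _; rewrite /small_parts_ok andbT.
  apply: eq_bigr => d _; rewrite exprS; congr (_ * _).
  rewrite /C -box_last ik /box -sumrB; apply: eq_bigr => a _.
  rewrite -sumrB; apply: eq_bigr => b _; rewrite -sumrB; apply: eq_bigr => c _.
  rewrite /small_parts_ok eqxx /=.
  have [->|c0] := eqVneq (c : nat) 0%N; last by rewrite andbT subr0.
  rewrite addn0 ltn_ord /=.
  by case: (h <= a)%N; rewrite /= ?subr0 ?subrr.
have -> : small_parts_sum i = (1 - z) * Fser i + z * C.
  by rewrite ik Fser_rec_last /C; ring.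
ring.
Qed.

End Series.

(** * Comparison with the counting function *)

Lemma msum0 (S : comNzRingType) (p : S) (ip ip2 : nat -> S) h u x :
  ip 0%N = 1 -> ip2 0%N = 1 -> msum p ip ip2 h u x 0 = 1.
Proof.
move=> e e2; elim: h => [|h' IH] /=; rewrite mul0n mul1r //.
by rewrite /bailey big_ord1 IH e !mulr1.
Qed.

Section Compare.
Variables (R : comNzRingType) (ip ip2 w : nat -> fps R) (h : nat).
Local Notation q := (fpsX : fps R).
Local Notation p := (q * q).
Hypothesis ipS : forall n, ip n = ip n.+1 * (1 - p ^+ n.+1).
Hypothesis ip2S : forall n, ip2 n = ip2 n.+1 * (1 - p ^+ (2 * n.+1)).
Hypothesis wS : forall n, w n.+1 = w n * (q * (1 + p ^+ n) * (1 + q * p ^+ n)).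
Hypotheses (ip0 : ip 0 = 1) (ip20 : ip2 0 = 1) (w0 : w 0 + w 0 = 1).

Local Notation F := (Fser fpsX ip ip2 w h).

Lemma Eser_const u : Eser fpsX ip ip2 w h u 0%N = w 0.
Proof.
rewrite /Eser /= /psum big_ord1 mulr1 msum0 ?mulr1 //.
- by rewrite ip0.
- by rewrite ip20.
Qed.

Lemma Fser_const i : (0 < i)%N -> F i 0%N = 1.
Proof. by rewrite /Fser; case: i => // i _; rewrite [RHS]/= fpsDE !Eser_const. Qed.

(** Replacing x by x p multiplies the coefficient of x^m' by q^(2m'), whence the 2 m' in n'. The
    test 0 < i' of [Otilde_rec] is taken over by F_0 = 0. *)
Lemma Fser_coef i m n : (0 < i <= h.+2)%N -> F i m n =
  \sum_(d < m.+1) \sum_(a < h.+2) \sum_(b < 2) \sum_(c < 2)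
    let i' := (h.+2 - (a + b + odd (a + c + i).-1))%N in
    let m' := (m - (a + b + c + d))%N in
    let n' := (2 * a + 2 * b + c + d + 2 * m')%N in
    if [&& small_parts_ok h i a c d, a + b + c + d <= m & n' <= n]%N
    then F i' m' (n - n')%N else 0.
Proof.
move=> ih; have [r ->] := Fser_box ipS ip2S wS m.+1 ih.
rewrite (fpsDE _ _ m) fpsXnM_coef ltnSn addr0.
do 4!(rewrite !fps_sumE; apply: eq_bigr => ? _).
cbv zeta; case: (small_parts_ok _ _ _ _ _); last by rewrite !fps0E.
rewrite andTb.
rewrite fpsXnM_coef ltnNge; case: leqP => _; last by rewrite fps0E.
rewrite fpsCM_coef dilE exprMn -exprD mulrA -exprD addnn -mul2n fpsXnM_coef.
by rewrite ltnNge; case: leqP.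
Qed.

(* The recurrence determines the coefficient of x^m q^n for m > 0, since each
   term on its right-hand side lowers m + n. *)
Lemma Fser_Otilde i m n : (0 < i <= h.+2)%N -> F i m n = (Otilde h.+2 i m n)%:R.
Proof.
have [N] := ubnP (m + n)%N; elim: N i m n => // N IH i m n mnN ih.
case: m mnN => [|m] mnN.
  by rewrite Fser_const ?fps1E ?Otilde_empty //; lia.
rewrite Fser_coef // Otilde_rec // natr_sum; apply: eq_bigr => d _.
rewrite natr_sum; apply: eq_bigr => a _.
rewrite natr_sum; apply: eq_bigr => b _.
rewrite natr_sum; apply: eq_bigr => c _ /=.
rewrite subn2 /=.
case: posnP => [->|i0]; first by rewrite Fser0 !fps0E !if_same andbF.
rewrite (fun_if (fun n => n%:R)) /=.
case: ifP => // /and3P[_ am nn]; rewrite IH //; last by rewrite i0; lia.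
by move: mnN; case: (_ + _ + _ + _)%N am nn; lia.
Qed.
End Compare.

(** * q-Pochhammer symbols as Laurent series *)

Lemma q_neq0 : q != 0.
Proof.
rewrite /q tofrac_eq0; apply/eqP => /(congr1 (fun f : fps rat => f 1%N)) /eqP.
by rewrite fps0E oner_eq0.
Qed.

Lemma fps_divisible_eq0 (g : fps rat) :
  (forall d, exists s, g = fpsX ^+ d * s) -> g = 0.
Proof.
move=> H; apply: fpsP => n; have [s ->] := H n.+1.
by rewrite fpsXnM_coef ltnSn fps0E.
Qed.

Lemma qadic_lim_unique u l l' : qadic_lim u l -> qadic_lim u l' -> l = l'.
Proof.
move=> ul ul'; apply/eqP; rewrite -subr_eq0.
have H d : exists s, l - l' = q ^+ d * tofrac s.
  have [B1 h1] := ul d; have [B2 h2] := ul' d.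
  have [s1 e1] := h1 _ (leq_maxl B1 B2); have [s2 e2] := h2 _ (leq_maxr B1 B2).
  exists (s2 - s1); rewrite rmorphB /= mulrBr -e1 -e2; ring.
have [s0] := H 0%N; rewrite mul1r => e0; rewrite e0 tofrac_eq0; apply/eqP.
apply: fps_divisible_eq0 => d; have [s] := H d; rewrite e0 -rmorphXn -rmorphM /=.
by move/eqP; rewrite tofrac_eq => /eqP ->; exists s.
Qed.

Definition qprod (a p : laurent) B := \prod_(j < B) (1 - a * p ^+ j).
(* Finite pole at q = 0: multiplying by 1 - a then preserves q-adic convergence. *)
Definition qfinite (a : laurent) := exists e t, a * q ^+ e = tofrac t.
Definition qpoch_ok (a p : laurent) := exists2 l, l != 0 & qadic_lim (qprod a p) l.

Lemma qpoch_infE a p l : qadic_lim (qprod a p) l -> qpoch_inf a p = l.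
Proof.
move=> al; rewrite /qpoch_inf.
case: xgetP => [l' _ al'|/(_ l)]; last by case.
exact: qadic_lim_unique al' al.
Qed.

Lemma qprodS a p B : qprod a p B.+1 = (1 - a) * qprod (a * p) p B.
Proof.
rewrite /qprod big_ord_recl mulr1; congr (_ * _).
by apply: eq_bigr => j _; rewrite exprS mulrA.
Qed.

Lemma qadic_lim_step a p l : qfinite a ->
  qadic_lim (qprod (a * p) p) l -> qadic_lim (qprod a p) ((1 - a) * l).
Proof.
(* Precision d + e is required of the tail, since the pole of a may cost e powers of q. *)
case=> e [t et] al d; have [B H] := al (d + e)%N.
exists B.+1; case=> // n nB; have [s es] := H n nB.
exists ((fpsX ^+ e - t) * s); rewrite qprodS -mulrBr es rmorphM rmorphB rmorphXn /= -et exprD.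
rewrite -/q; ring.
Qed.

Lemma qpoch_ok_step a p : qfinite a -> a != 1 ->
  qpoch_ok (a * p) p -> qpoch_ok a p.
Proof.
move=> fa a1 [l l0 al]; exists ((1 - a) * l); last exact: qadic_lim_step.
by rewrite mulf_neq0 // subr_eq0 eq_sym.
Qed.

Lemma qpoch_inf_step a p : qfinite a -> qpoch_ok (a * p) p ->
  qpoch_inf a p = (1 - a) * qpoch_inf (a * p) p.
Proof.
move=> fa [l _ al]; rewrite (qpoch_infE al); apply: qpoch_infE.
exact: qadic_lim_step.
Qed.

Lemma qpoch_inf_neq0 a p : qpoch_ok a p -> qpoch_inf a p != 0.
Proof. by case=> l l0 /qpoch_infE ->. Qed.

(** The coefficient of q^t is stable from the t-th partial product on, and the limit has constant
    term 1. *)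
Lemma qpoch_ok_pos (a p : fps rat) : qpoch_ok (tofrac (fpsX * a)) (tofrac (fpsX * p)).
Proof.
pose P n : fps rat := \prod_(j < n) (1 - fpsX * a * (fpsX * p) ^+ j).
have PS n t : (t <= n)%N -> P n.+1 t = P n t.
  move=> tn; have -> : P n.+1 = P n - fpsX ^+ n.+1 * (P n * a * p ^+ n).
    by rewrite /P big_ord_recr /= exprMn exprS; ring.
  by rewrite fpsBE fpsXnM_coef ltnS tn subr0.
have Pst n t : (t <= n)%N -> P n t = P t t.
  move=> tn; rewrite -(subnKC tn); elim: (n - t)%N => [|r IH]; first by rewrite addn0.
  by rewrite addnS PS ?IH // leq_addr.
pose L := Fps (fun t => P t t).
exists (tofrac L).
  rewrite tofrac_eq0; apply/eqP => /(congr1 (fun f : fps rat => f 0%N)).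
  by rewrite fps0E /= /P big_ord0 fps1E => /eqP; rewrite oner_eq0.
move=> d; exists d => n dn.
have [|s es] := @fps_divXn _ d (P n - L).
  by move=> t td; rewrite fpsBE /= Pst ?subrr //; apply: leq_trans dn; apply: ltnW.
exists s; rewrite -[q ^+ d]rmorphXn -rmorphM /= -es rmorphB /=; congr (_ - _).
rewrite rmorph_prod; apply: eq_bigr => j _.
by rewrite rmorphB rmorph1 !rmorphM rmorphXn rmorphM.
Qed.

Lemma qadic_lim_steps a p n l : (forall j, (j < n)%N -> qfinite (a * p ^+ j)) ->
  qadic_lim (qprod (a * p ^+ n) p) l -> qadic_lim (qprod a p) (qprod a p n * l).
Proof.
elim: n a => [|n IH] a fa; first by rewrite mulr1 /qprod big_ord0 mul1r.
move=> al; rewrite qprodS -mulrA; apply: qadic_lim_step.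
  by have := fa 0%N isT; rewrite mulr1.
apply: IH => [j jn|]; first by rewrite -mulrA -exprS; apply: fa.
by rewrite -mulrA -exprS.
Qed.

(** The first n factors split off, and the common tail cancels because its limit is nonzero. *)
Lemma qpoch_nat a p n : (forall j, (j < n)%N -> qfinite (a * p ^+ j)) ->
  qpoch_ok (a * p ^+ n) p -> qpoch a p n%:Z = qprod a p n.
Proof.
move=> fa [l l0 al]; rewrite /qpoch -exprnP (qpoch_infE al).
by rewrite (qpoch_infE (qadic_lim_steps fa al)) mulfK.
Qed.

Lemma qfinite_fps (t : fps rat) : qfinite (tofrac t).
Proof. by exists 0%N, t; rewrite mulr1. Qed.

Lemma qfinite_opp_qz (z : int) : qfinite (- q ^ z).
Proof.
exists `|z|%N; case: z => n.
  by exists (- (fpsX ^+ n * fpsX ^+ n)); rewrite mulNr -exprnP rmorphN rmorphM rmorphXn.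
exists (- 1); rewrite mulNr NegzE -exprnN abszN absz_nat mulVf ?rmorphN ?rmorph1 //.
by rewrite expf_neq0 ?q_neq0.
Qed.

Lemma qXE n : q ^+ n = tofrac (fpsX ^+ n). Proof. by rewrite rmorphXn. Qed.

Lemma qpoch_ok_q (e b : nat) : (0 < e)%N -> (0 < b)%N -> qpoch_ok (q ^+ e) (q ^+ b).
Proof. by case: e b => // e [|b] // _ _; rewrite !qXE !exprS; apply: qpoch_ok_pos. Qed.

Lemma qpoch_ok_Nq (e b : nat) : (0 < b)%N -> qpoch_ok (- q ^+ e) (q ^+ b).
Proof.
case: e b => [|e] [|b] // _; last first.
  by rewrite !qXE !exprS -rmorphN /= -mulrN; apply: qpoch_ok_pos.
apply: qpoch_ok_step.
- by rewrite expr0 -(rmorph1 (@tofrac _)) -rmorphN; apply: qfinite_fps.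
- by rewrite expr0 eq_sym -subr_eq0 opprK -(rmorph1 (@tofrac _)) -rmorphD tofrac_eq0;
    apply/eqP => /(congr1 (fun f : fps rat => f 0%N)).
- by rewrite mulNr -exprD add0n !qXE !exprS -rmorphN /= -mulrN; apply: qpoch_ok_pos.
Qed.

Lemma qpoch_qq b n : (0 < b)%N ->
  qpoch (q ^+ b) (q ^+ b) n%:Z = \prod_(j < n) (1 - q ^+ (b * j.+1)).
Proof.
move=> b0; rewrite qpoch_nat.
- by apply: eq_bigr => j _; rewrite -exprM -exprD mulnS.
- by move=> j _; rewrite -exprM -exprD qXE; apply: qfinite_fps.
- by rewrite -exprM -exprD; apply: qpoch_ok_q => //; rewrite addn_gt0 b0.
Qed.

(** The exponent z may be negative, but the exponent e at which the tail begins is not, so the tail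
    has a nonzero limit. *)
Lemma qpoch_Nqz (z : int) n (e : nat) : z + (2 * n)%:Z = e%:Z ->
  qpoch (- q ^ z) (q ^+ 2) n%:Z = \prod_(j < n) (1 + q ^ (z + (2 * j)%:Z)).
Proof.
have qz (j : nat) : - q ^ z * (q ^+ 2) ^+ j = - q ^ (z + (2 * j)%:Z).
  by rewrite mulNr -exprM [q ^+ _]exprnP -expfzDr ?q_neq0.
move=> ze; rewrite qpoch_nat.
- by apply: eq_bigr => j _; rewrite qz opprK.
- by move=> j _; rewrite qz; apply: qfinite_opp_qz.
- by rewrite qz ze; apply: qpoch_ok_Nq.
Qed.

(** The denominator begins one factor earlier than the numerator, with 1 - (-1) = 2. *)
Lemma qpoch_m1 : qpoch (- q ^+ 2) (q ^+ 2) (-1) = 2^-1.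
Proof.
have E : - q ^+ 2 * (q ^+ 2) ^ (-1 : int) = - 1.
  by rewrite mulNr mulfV // expf_neq0 ?q_neq0.
have ok := @qpoch_ok_Nq 2 2 isT.
rewrite /qpoch E (@qpoch_inf_step (-1)); last 2 first.
- by rewrite -(rmorph1 (@tofrac _)) -rmorphN; apply: qfinite_fps.
- by rewrite mulN1r.
by rewrite mulN1r opprK invfM mulrCA mulfV ?mulr1 //; apply: qpoch_inf_neq0.
Qed.

(** * Expansion of the multisum over chains *)

Section Chains.
Variables (R : comNzRingType) (p : R) (ip ip2 : nat -> R).

Fixpoint chains h N : seq (seq nat) :=
  if h is h'.+1 then
    [seq M :: s | M <- iota 0 N.+1, s <- chains h' M]
  else [:: [::]].

Lemma chainsS h N :
  chains h.+1 N = [seq M :: s | M <- iota 0 N.+1, s <- chains h M].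
Proof. by []. Qed.

Lemma mem_chains h N s : (s \in chains h N) = (size s == h) && path geq N s.
Proof.
elim: h N s => [|h IH] N s; first by rewrite inE; case: s.
rewrite chainsS.
apply/allpairsPdep/idP => [[M [t [MN]]]|].
  rewrite IH => /andP[/eqP <- pt] ->; rewrite /= eqxx pt andbT.
  by rewrite mem_iota in MN.
case: s => // M t /andP[/eqP st]; rewrite [path _ _ _]/= => /andP[MN pt].
exists M, t.
split=> //; first by rewrite mem_iota add0n ltnS.
by rewrite IH pt andbT; apply/eqP; case: st.
Qed.

Lemma chains_uniq h N : uniq (chains h N).
Proof.
elim: h N => // h IH N; rewrite chainsS; apply: allpairs_uniq_dep; first exact: iota_uniq.
  by move=> M _; apply: IH.
by move=> [a s] [b t] _ _ /= [-> ->].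
Qed.

(** The summand of [msum] at the chain [N :: s], without its power of x. *)
Fixpoint mterm h u N (s : seq nat) : R :=
  p ^+ (N * (h < u)) *
  (if h is h'.+1 then
     p ^+ (head 0%N s ^ 2) * ip (N - head 0%N s) * mterm h' u (head 0%N s) (behead s)
   else ip2 N).

Lemma mtermE h u N s : mterm h u N s =
  p ^+ (\sum_(j < h.+1) nth 0%N (N :: s) j * (h - j < u)
        + \sum_(j < h) nth 0%N s j ^ 2)%N
  * (\prod_(j < h) ip (nth 0%N (N :: s) j - nth 0%N s j)) * ip2 (nth 0%N (N :: s) h).
Proof.
elim: h N s => [|h IH] N s.
  by rewrite big_ord1 !big_ord0 addn0 mulr1 /=.
rewrite /= IH {IH}.
have E j : nth 0%N (head 0%N s :: behead s) j = nth 0%N s j.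
  by case: s j => [|? ?] [|j] //=; rewrite nth_nil.
have e1 : (\sum_(j < h.+1) nth 0%N (head 0%N s :: behead s) j * (h - j < u) =
           \sum_(j < h.+1) nth 0%N s j * (h - j < u))%N.
  by apply: eq_bigr => j _; rewrite E.
have e2 : (\sum_(j < h) nth 0%N (behead s) j ^ 2 = \sum_(j < h) nth 0%N s j.+1 ^ 2)%N.
  by apply: eq_bigr => j _; rewrite nth_behead.
have e3 : \prod_(j < h) ip (nth 0%N (head 0%N s :: behead s) j - nth 0%N (behead s) j)
   = \prod_(j < h) ip (nth 0%N s j - nth 0%N s j.+1).
  by apply: eq_bigr => j _; rewrite E nth_behead.
rewrite e1 e2 e3 E.
have f1 : (\sum_(j < h.+2) nth 0%N (N :: s) j * (h.+1 - j < u) =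
   N * (h.+1 < u) + \sum_(j < h.+1) nth 0%N s j * (h - j < u))%N.
  by rewrite big_ord_recl /= subn0.
have f2 : (\sum_(j < h.+1) nth 0%N s j ^ 2 =
   head 0%N s ^ 2 + \sum_(j < h) nth 0%N s j.+1 ^ 2)%N.
  by rewrite big_ord_recl nth0.
have f3 : \prod_(j < h.+1) ip (nth 0%N (N :: s) j - nth 0%N s j)
   = ip (N - head 0%N s) * \prod_(j < h) ip (nth 0%N s j - nth 0%N s j.+1).
  by rewrite big_ord_recl nth0.
by rewrite f1 f2 f3 !exprD; ring.
Qed.

End Chains.

Lemma msum_chains (S : comNzRingType) (p : S) (ip ip2 : nat -> S) h u N :
  msum (fpsC p) (fun n => fpsC (ip n)) (fun n => fpsC (ip2 n)) h u fpsX N =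
  \sum_(s <- chains h N) fpsC (mterm p ip ip2 h u N s) * fpsX ^+ sumn s.
Proof.
elim: h N => [|h IH] N.
  by rewrite big_seq1 /= mulr1 rmorphM rmorphXn.
rewrite chainsS big_allpairs_dep [LHS]/= /bailey mulr_sumr.
rewrite -[iota 0 N.+1]/(index_iota 0 N.+1) big_mkord; apply: eq_bigr => M _.
rewrite IH !mulr_sumr; apply: eq_bigr => s _ /=.
rewrite !rmorphM !rmorphXn exprD /=; ring.
Qed.

(** The entries of a chain with sum m are at most m, so [chains h.+1 m] contains all of them. *)
Lemma Eser_chains (S : comNzRingType) (q : S) (ip ip2 w : nat -> S) h u m :
  Eser q ip ip2 w h u m =
  \sum_(l <- chains h.+1 m | sumn l == m)
    w (head 0%N l) * mterm (q * q) ip ip2 h u (head 0%N l) (behead l).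
Proof.
rewrite /Eser [LHS]/= /psum fps_sumE [RHS]big_mkcond chainsS big_allpairs_dep.
rewrite -[iota 0 m.+1]/(index_iota 0 m.+1) big_mkord; apply: eq_bigr => N _.
rewrite msum_chains -mulrA mulr_sumr fpsCM_coef fps_sumE mulr_sumr; apply: eq_bigr => s _.
rewrite mulrA [_ * fpsC _]mulrC -mulrA -exprD fpsCM_coef /=.
rewrite -[fpsX ^+ _]mulr1 fpsXnM_coef fps1E.
case: ltnP => [lt|le]; first by rewrite mulr0 mulr0 gtn_eqF.
by rewrite subn_eq0 eqn_leq le /=; case: leqP; rewrite ?mulr1 ?mulr0.
Qed.

(** * The factors of the summand as power series in q *)

Definition geom (e : nat) : fps rat := Fps (fun n => (e %| n)%:R).

Lemma geomE e : (0 < e)%N -> geom e * (1 - fpsX ^+ e) = 1.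
Proof.
move=> e0; apply: fpsP => n.
rewrite mulrC mulrBl mul1r fpsBE fpsXnM_coef fps1E.
case: ltnP => [ne|en].
  rewrite subr0 /=; congr (_%:R); congr (nat_of_bool _).
  by apply/idP/eqP => [|-> //]; apply: contraTeq; rewrite -lt0n => n0; rewrite gtnNdvd.
rewrite /= dvdn_subl ?dvdnn // subrr.
by rewrite gtn_eqF // (leq_trans e0).
Qed.

Lemma tofrac_geom e : (0 < e)%N -> tofrac (geom e) = (1 - q ^+ e)^-1.
Proof.
move=> e0; have /(congr1 (@tofrac _)) := geomE e0.
rewrite rmorphM rmorphB rmorph1 rmorphXn -/q => E.
have n0 : 1 - q ^+ e != 0.
  by apply/eqP => e1; move: E; rewrite e1 mulr0 => /esym/eqP; rewrite oner_eq0.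
by apply: (mulIf n0); rewrite mulVf.
Qed.

Definition ipq b n : fps rat := \prod_(l < n) geom (b * l.+1).
(* This is (-q;q)_(2n-1) q^n, where (-q;q)_(-1) = 1/2 gives the first factor. *)
Definition wq n : fps rat :=
  fpsC 2^-1 * \prod_(l < n) (fpsX * (1 + fpsX ^+ (2 * l)) * (1 + fpsX ^+ (2 * l).+1)).

Lemma ipqS b n : (0 < b)%N -> ipq b n = ipq b n.+1 * (1 - fpsX ^+ (b * n.+1)).
Proof.
by move=> b0; rewrite /ipq big_ord_recr -mulrA geomE ?mulr1 // muln_gt0 b0.
Qed.

Lemma tofrac_ipq b n : (0 < b)%N ->
  tofrac (ipq b n) = (qpoch (q ^+ b) (q ^+ b) n%:Z)^-1.
Proof.
move=> b0; rewrite qpoch_qq // /ipq rmorph_prod -prodfV.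
by apply: eq_bigr => j _; rewrite /= tofrac_geom // muln_gt0 b0.
Qed.

(** Each 1 + t^(-j) is t^(-j) (1 + t^j). These j add up to n(n+1) + (n+1)^2, which is n + 1 less
    than 2(n+1)^2: one factor t remains for each l. The factor 2 at l = 0 cancels 1/2. *)
Lemma weight_prod (K : fieldType) (t : K) n : t != 0 -> 1 + 1 != 0 :> K ->
  \prod_(j < n) (1 + (t ^+ (2 * j.+1))^-1)
  * \prod_(j < n.+1) (1 + (t ^+ (2 * j).+1)^-1) * t ^+ (2 * n.+1 ^ 2)
  = 2^-1 * \prod_(l < n.+1) (t * (1 + t ^+ (2 * l)) * (1 + t ^+ (2 * l).+1)).
Proof.
move=> t0 n2; elim: n => [|n IH].
  rewrite !big_ord_recr !big_ord0 /= !muln0 expr0 expr1.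
  by field; apply/andP.
rewrite big_ord_recr [\prod_(j < n.+2) (1 + _)]big_ord_recr /=.
rewrite [in RHS]big_ord_recr [RHS]mulrA -{}IH /=.
have -> : (2 * n.+2 ^ 2 = 2 * n.+1 ^ 2 + (2 * n.+1 + (2 * n.+1).+1 + 1))%N by lia.
rewrite !exprD expr1.
have : t ^+ (2 * n.+1) != 0 by rewrite expf_neq0.
have : t ^+ (2 * n.+1).+1 != 0 by rewrite expf_neq0.
set u := t ^+ (2 * n.+1); set v := t ^+ _.+1 => h1 h2.
move: (\prod_(i < n) _) (\prod_(i < n.+1) _) (t ^+ _) => A B C.
by field; apply/andP.
Qed.

Lemma qpoch_weight N :
  qpoch (- q ^ (2 - 2 * N%:Z)) (q ^+ 2) (N%:Z - 1)
  * qpoch (- q ^ (1 - 2 * N%:Z)) (q ^+ 2) N%:Z * q ^+ (2 * N ^ 2) = tofrac (wq N).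
Proof.
have half : tofrac (fpsC 2^-1 : fps rat) = 2^-1.
  have n2 : (2 : laurent) != 0.
    rewrite -(rmorph_nat (@tofrac _)) tofrac_eq0.
    by apply/eqP => /(congr1 (fun f : fps rat => f 0%N)).
  apply: (mulIf n2); rewrite mulVf // -(rmorph_nat (@tofrac _)) -rmorphM.
  rewrite -(rmorph_nat (@fpsC _)) -rmorphM mulVf //.
have q0 := q_neq0.
case: N => [|n].
  rewrite mulr0 !subr0 sub0r qpoch_m1 (@qpoch_Nqz _ 0 1) //.
  by rewrite big_ord0 !mulr1 /wq big_ord0 mulr1 half.
have e1 : n.+1%:Z - 1 = n%:Z by lia.
rewrite e1 (@qpoch_Nqz _ n 0); last by lia.
rewrite (@qpoch_Nqz _ n.+1 1); last by lia.
(* Reversal turns the exponents into -2(j+1) and -(2j+1). *)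
rewrite (reindex_inj rev_ord_inj) [X in _ * X * _](reindex_inj rev_ord_inj) /=.
have -> : \prod_(j < n) (1 + q ^ (2 - 2 * n.+1%:Z + (2 * (n - j.+1))%:Z))
    = \prod_(j < n) (1 + (q ^+ (2 * j.+1))^-1).
  apply: eq_bigr => j _; congr (1 + _).
  have := ltn_ord j; rewrite exprnN => jn; congr (q ^ _); lia.
have -> : \prod_(j < n.+1) (1 + q ^ (1 - 2 * n.+1%:Z + (2 * (n.+1 - j.+1))%:Z))
    = \prod_(j < n.+1) (1 + (q ^+ (2 * j).+1)^-1).
  apply: eq_bigr => j _; congr (1 + _).
  have := ltn_ord j; rewrite exprnN => jn; congr (q ^ _); lia.
rewrite /wq rmorphM /= half rmorph_prod /=.
have -> : \prod_(l < n.+1) tofrac (fpsX * (1 + fpsX ^+ (2 * l)) * (1 + fpsX ^+ (2 * l).+1) : fps rat)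
  = \prod_(l < n.+1) (q * (1 + q ^+ (2 * l)) * (1 + q ^+ (2 * l).+1)).
  by apply: eq_bigr => l _; rewrite !rmorphM !rmorphD !rmorph1 !rmorphXn.
apply: weight_prod => //.
rewrite -(rmorph1 (@tofrac _)) -rmorphD tofrac_eq0.
by apply/eqP => /(congr1 (fun f : fps rat => f 0%N)).
Qed.

Definition multisum_term (k i : nat) (Ns : seq nat) : laurent :=
  let N (j : nat) : nat := nth 0%N Ns j.-1 in
         (qpoch (- q ^ (2 - 2 * (N 1%N)%:Z)) (q ^+ 2) ((N 1%N)%:Z - 1)
          * qpoch (- q ^ (1 - 2 * (N 1%N)%:Z)) (q ^+ 2) (N 1%N)%:Z
          * q ^+ (2 * (\sum_(1 <= j < k) N j ^ 2 + \sum_(i.+1 <= j < k) N j))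
          * (1 + q ^+ (2 * N i))
          / ((\prod_(1 <= j < k.-1)
                qpoch (q ^+ 2) (q ^+ 2) ((N j)%:Z - (N j.+1)%:Z))
             * qpoch (q ^+ 4) (q ^+ 4) (N k.-1)%:Z)).

Local Notation mtermq := (mterm (fpsX * fpsX : fps rat) (ipq 2) (ipq 4)).

Lemma sum_weighted_tail h v (l : seq nat) : (v <= h)%N ->
  (\sum_(j < h.+1) nth 0 l j * (h - j < h.+1 - v) = \sum_(v <= j < h.+1) nth 0 l j)%N.
Proof.
move=> vh; rewrite big_geq_mkord [RHS]big_mkcond; apply: eq_bigr => j _ /=.
have jh := ltn_ord j.
have -> : (h - j < h.+1 - v)%N = (v <= j)%N by lia.
by case: (v <= j)%N; rewrite ?muln1 ?muln0.
Qed.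

(** Expanding 1 + q^(2N_i) gives two terms: the variables carrying p^(N_j) are N_i, ..., N_(k-1) in
    one and N_(i+1), ..., N_(k-1) in the other. The power q^(2N_1^2) is absorbed into [wq N]. *)
Lemma multisum_termE h i N s : (0 < i <= h.+1)%N -> size s = h -> path geq N s ->
  multisum_term h.+2 i (N :: s) =
  tofrac (wq N * mtermq h (h.+2 - i) N s + wq N * mtermq h (h.+1 - i) N s).
Proof.
move=> ih sh ps; rewrite -mulrDr rmorphM /= -qpoch_weight /multisum_term /=.
set A := qpoch _ _ _; set B := qpoch _ _ _.
rewrite !mtermE.
have sq : (\sum_(1 <= j < h.+2) nth 0 (N :: s) j.-1 ^ 2 = N ^ 2 + \sum_(j < h) nth 0 s j ^ 2)%N.
  by rewrite big_add1 big_mkord big_ord_recl.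
have tl : (\sum_(i.+1 <= j < h.+2) nth 0 (N :: s) j.-1 = \sum_(i <= j < h.+1) nth 0 (N :: s) j)%N.
  by rewrite big_add1.
rewrite sq tl.
have -> : (\sum_(j < h.+1) nth 0 (N :: s) j * (h - j < h.+2 - i)
   = nth 0 (N :: s) i.-1 + \sum_(i <= j < h.+1) nth 0 (N :: s) j)%N.
  have -> : (h.+2 - i = h.+1 - i.-1)%N by lia.
  rewrite sum_weighted_tail; last by lia.
  by rewrite big_ltn; [rewrite prednK //; lia|lia].
have -> : (\sum_(j < h.+1) nth 0 (N :: s) j * (h - j < h.+1 - i)
   = \sum_(i <= j < h.+1) nth 0 (N :: s) j)%N.
  have [ih'|hi'] := leqP i h; first exact: sum_weighted_tail.
  by rewrite big_geq ?big1 // => j _; rewrite (_ : (_ < _)%N = false) ?muln0 //; lia.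
have dn : \prod_(1 <= j < h.+1) qpoch (q ^+ 2) (q ^+ 2)
      ((nth 0%N (N :: s) j.-1)%:Z - (nth 0%N (N :: s) j)%:Z)
  = (tofrac (\prod_(j < h) ipq 2 (nth 0%N (N :: s) j - nth 0%N s j)))^-1.
  rewrite big_add1 big_mkord rmorph_prod -prodfV; apply: eq_bigr => j _ /=.
  rewrite tofrac_ipq // invrK subzn //.
  by apply: (pathP 0%N ps); rewrite sh.
have qX n : tofrac ((fpsX * fpsX : fps rat) ^+ n) = q ^+ (2 * n).
  by rewrite rmorphXn rmorphM exprM expr2.
have ip4 : tofrac (ipq 4 (nth 0%N (N :: s) h)) =
    (qpoch (q ^+ 4) (q ^+ 4) (nth 0%N (N :: s) h)%:Z)^-1.
  exact: tofrac_ipq.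
rewrite dn invfM invrK rmorphD !rmorphM /= ip4 !qX !mulnDr !exprD.
move: (\prod_(j < h) _) => P; move: (tofrac P) => {P dn} P.
move: (qpoch _ _ _)^-1 A B => Q A B.
move: (q ^+ _) (q ^+ _) (q ^+ _) (q ^+ _) => a b c d.
ring.
Qed.

(** * Comparison of the coefficients of x^m *)

Theorem theorem1p14 (k i : nat) (hi : (1 <= i)%N) (hik : (i < k)%N) :
  fps_has_sum
    (fun Ns : k.-1.-tuple nat => sorted geq Ns)
    (fun Ns : k.-1.-tuple nat =>
       let N (j : nat) : nat := nth 0%N Ns j.-1 in
       fpsC
         (qpoch (- q ^ (2 - 2 * (N 1%N)%:Z)) (q ^+ 2) ((N 1%N)%:Z - 1)
          * qpoch (- q ^ (1 - 2 * (N 1%N)%:Z)) (q ^+ 2) (N 1%N)%:Z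
          * q ^+ (2 * (\sum_(1 <= j < k) N j ^ 2 + \sum_(i.+1 <= j < k) N j))
          * (1 + q ^+ (2 * N i))
          / ((\prod_(1 <= j < k.-1)
                qpoch (q ^+ 2) (q ^+ 2) ((N j)%:Z - (N j.+1)%:Z))
             * qpoch (q ^+ 4) (q ^+ 4) (N k.-1)%:Z))
       * fpsX ^+ (\sum_(1 <= j < k) N j)%N)
    (O_genfun k i).
Proof.
case: k hik => [|[|h]] // hik; first by lia.
(* This finite set holds every nonincreasing tuple with sum m; tuples with another sum contribute
   nothing to x^m. *)
move=> m; exists (pmap insub (chains h.+1 m)) => s us sub.
rewrite fps_sumE.
transitivity (\sum_(Ns <- s | sorted geq Ns && (sumn Ns == m)) multisum_term h.+2 i Ns).
  rewrite [in RHS]big_mkcondr; apply: eq_bigr => Ns _.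
  rewrite fpsCM_coef -/(multisum_term h.+2 i Ns).
  have -> : (\sum_(1 <= j < h.+2) nth 0 Ns j.-1 = sumn Ns)%N.
    by rewrite big_add1 sumnE [RHS](big_nth 0%N) size_tuple.
  rewrite -[fpsX ^+ _]mulr1 fpsXnM_coef fps1E [in RHS]eqn_leq.
  case: ltnP => [lt|le]; rewrite ?mulr0 //=.
  by rewrite subn_eq0; case: (_ <= _)%N; rewrite ?mulr1 ?mulr0.
have pq : perm_eq [seq Ns : h.+1.-tuple nat <- s | sorted geq Ns & sumn Ns == m]
   [seq Ns : h.+1.-tuple nat <- pmap insub (chains h.+1 m) | sumn Ns == m].
  apply: uniq_perm; first exact: filter_uniq.
    by rewrite filter_uniq // pmap_sub_uniq // chains_uniq.
  move=> Ns; rewrite !mem_filter mem_pmap_sub mem_chains size_tuple eqxx /=.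
  case: eqP => [sm|_]; last by rewrite andbF.
  have -> : sorted geq Ns = path geq m Ns.
    by rewrite -sm; case: (tval Ns) => //= x t; rewrite leq_addr.
  rewrite andbT; apply: andb_idr => pN; apply: sub.
  by rewrite mem_pmap_sub mem_chains size_tuple eqxx.
rewrite -big_filter (perm_big _ pq) big_filter.
transitivity (\sum_(l <- chains h.+1 m | sumn l == m) multisum_term h.+2 i l).
  have E : map val (pmap insub (chains h.+1 m) : seq (h.+1.-tuple nat)) = chains h.+1 m.
    rewrite (pmap_filter (@insubK _ _ _)); apply/all_filterP/allP => l.
    by rewrite mem_chains => /andP[sl _] /=; case: insubP => //; rewrite sl.
  by rewrite -[in RHS]E big_map.
rewrite -[RHS]/(tofrac _).
have -> : Fps (fun n => (Otilde h.+2 i m n)%:R) = Fser fpsX (ipq 2) (ipq 4) wq h i m.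
  apply: fpsP => n; rewrite Fser_Otilde //.
  - by move=> t; rewrite ipqS // exprM expr2.
  - by move=> t; rewrite ipqS // -expr2 -exprM mulnA.
  - move=> t; rewrite /wq big_ord_recr /= mulrA -expr2 -exprM -exprS; ring.
  - by rewrite /ipq big_ord0.
  - by rewrite /ipq big_ord0.
  - by rewrite /wq big_ord0 mulr1 -rmorphD /= -[X in fpsC X]/(2^-1 + 2^-1); congr fpsC.
  - by lia.
rewrite Fser_mid; last by lia.
rewrite fpsDE !Eser_chains -big_split rmorph_sum.
rewrite big_seq_cond [RHS]big_seq_cond; apply: eq_bigr => l.
rewrite mem_chains => /andP[/andP[/eqP sl pl] _].
case: l sl pl => // N s' [sh] /andP[_ ps].
by apply: multisum_termE => //; lia.
Qed.
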